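(* Let $n\ge 1$ be an integer, let $\alpha>0$ and $\beta>0$, and let $X_1,\dots,X_n$ be i.i.d. $\mathrm{Gamma}(\alpha,\beta)$ random variables (shape $\alpha$, rate $\beta$). Let $\boldsymbol{\lambda}=(\lambda_1,\dots,\lambda_n)$ and $\boldsymbol{\mu}=(\mu_1,\dots,\mu_n)$ be real vectors such that $\boldsymbol{\mu}\prec\boldsymbol{\lambda}$ (that is, $\boldsymbol{\lambda}$ majorizes $\boldsymbol{\mu}$), and put $s=\sum_{i=1}^n\lambda_i=\sum_{i=1}^n\mu_i$. Then, for real $x>0$: (1) $P(\boldsymbol{\mu};\alpha,\beta,x)\ \ge\ P(\boldsymbol{\lambda};\alpha,\beta,x)$ for all $x>\dfrac{(2\alpha+1)s}{2\beta}$; (2) if $n=2$, then $P(\boldsymbol{\mu};\alpha,\beta,x)\ \le\ P(\boldsymbol{\lambda};\alpha,\beta,x)$ for all $x<\dfrac{\alpha s}{\beta}$; (3) if $n\ge 3$ and $\alpha>1$, then $P(\boldsymbol{\mu};\alpha,\beta,x)\ \le\ P(\boldsymbol{\lambda};\alpha,\beta,x)$ for all $x<\dfrac{(\alpha-1)s}{\beta}$.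
   Context: $\mathrm{Gamma}(\alpha,\beta)$ denotes the gamma distribution with shape $\alpha>0$ and rate $\beta>0$, with density $f(x)=\frac{\beta^{\alpha}}{\Gamma(\alpha)}x^{\alpha-1}e^{-\beta x}$ for $x>0$ and $f(x)=0$ for $x\le 0$. For a vector $\boldsymbol{\lambda}=(\lambda_1,\dots,\lambda_n)$ of non-negative reals and $x>0$, with $X_1,\dots,X_n$ i.i.d. $\mathrm{Gamma}(\alpha,\beta)$, define $$P(\boldsymbol{\lambda};\alpha,\beta,x):=\Pr\Big(\sum_{i=1}^n\lambda_iX_i<x\Big).$$ Majorization: $\boldsymbol{\mu}\prec\boldsymbol{\lambda}$ means that $0\le\lambda_n\le\dots\le\lambda_2\le\lambda_1$; $0<\mu_n\le\dots\le\mu_2\le\mu_1$; $\sum_{i=1}^k\mu_i\le\sum_{i=1}^k\lambda_i$ for all $k<n$; and $\sum_{i=1}^n\mu_i=\sum_{i=1}^n\lambda_i$. (The components of $\boldsymbol{\mu}$ are strictly positive, while those of $\boldsymbol{\lambda}$ are only required to be non-negative.) *)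

(* Defs.v *)
From HB Require Import structures.
From mathcomp Require Import all_boot all_order all_algebra.
From mathcomp Require Import all_classical all_reals all_analysis.

Set Implicit Arguments.
Unset Strict Implicit.
Unset Printing Implicit Defensive.

Import Order.TTheory GRing.Theory Num.Theory.
Import numFieldNormedType.Exports.

Local Open Scope classical_set_scope.
Local Open Scope ring_scope.

Definition gamma_fun {R : realType} (a : R) : R :=
  \int[lebesgue_measure]_(t in `]0, +oo[) (t `^ (a - 1) * expR (- t)).

(* [a] is the shape and [b] the rate (not the scale). *)
Definition gamma_pdf {R : realType} (a b x : R) : R :=
  if 0 < x then b `^ a / gamma_fun a * x `^ (a - 1) * expR (- b * x) else 0.

Definition gamma_prob {R : realType} (a b : R) (V : set R) : \bar R :=
  (\int[lebesgue_measure]_(x in V) (gamma_pdf a b x)%:E)%E.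

Definition mutually_independent {R : realType} d (T : measurableType d)
    (P : probability T R) (I : finType) (X : I -> {RV P >-> R}) : Prop :=
  forall (J : {set I}) (A : I -> set R), (forall i, measurable (A i)) ->
    P (\bigcap_(i in [set` J]) X i @^-1` A i) =
    (\prod_(i in J) P (X i @^-1` A i))%E.

Definition iid_gamma {R : realType} d (T : measurableType d)
    (P : probability T R) (n : nat) (X : 'I_n -> {RV P >-> R}) (a b : R) : Prop :=
  mutually_independent X /\
  forall (i : 'I_n) (V : set R), measurable V ->
    distribution P (X i) V = gamma_prob a b V.

Definition weighted_sum_prob {R : realType} d (T : measurableType d)
    (P : probability T R) (n : nat) (X : 'I_n -> {RV P >-> R})
    (lam : 'rV[R]_n) (x : R) : \bar R :=
  P [set w | \sum_(i < n) lam 0 i * X i w < x].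

Definition nonincreasing_row {R : realType} (n : nat) (v : 'rV[R]_n) : Prop :=
  forall i j : 'I_n, (i <= j)%N -> v 0 j <= v 0 i.

(* The relation is asymmetric on purpose: the majorized vector [mu] must be
   positive, the majorizing vector [lam] only nonnegative. *)
Record majorized {R : realType} (n : nat) (mu lam : 'rV[R]_n) : Prop :=
  Majorized {
    majorized_lam_ge0 : forall i, 0 <= lam 0 i;
    majorized_lam_sorted : nonincreasing_row lam;
    majorized_mu_gt0 : forall i, 0 < mu 0 i;
    majorized_mu_sorted : nonincreasing_row mu;
    majorized_psum : forall k : nat, (k < n)%N ->
      \sum_(i < n | (i < k)%N) mu 0 i <= \sum_(i < n | (i < k)%N) lam 0 i;
    majorized_sum : \sum_(i < n) mu 0 i = \sum_(i < n) lam 0 i }.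

(* Main.v *)
Require Import Defs.
From HB Require Import structures.
From mathcomp Require Import all_boot all_order all_algebra.
From mathcomp Require Import all_classical all_reals all_analysis.
From mathcomp Require Import measurable_realfun.
From mathcomp Require Import ring lra.

(** Write [W] for the weighted sum and [Phi lam x = P (W < x)],
    [K lam x = E (x - W)_+], so that [K] is convex in [x] with slope [Phi].

    A majorization is a chain of transfers, each moving an amount [e] from a
    weight to a smaller one without reversing their order
    ([transfer_majorization]).  Along a transfer from [i] to [j] the derivative
    of [K] is [E ((X i - X j) 1_{W < x})], and integrating by parts against the
    gamma density turns it into [- (lam i - lam j) / a * f x]
    ([ltmom_unit_diff]), where [f] is the derivative of [E (X i * X j 1_{W < x})].
    Raising [X i] to a power inside the expectation raises the shape of its law,
    so up to a constant [f] is the density of [W] with the shapes of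
    [X i] and [X j] raised by one.  Hence [Phi] decreases along the transfer
    where [f] increases, and increases where [f] decreases, and the theorem
    reduces to locating the mode of [f]: with [s] the sum of the weights, [f]
    increases up to [((a - 1) s + lam i + lam j) / b] and decreases from
    [(a + 1/2) s / b] on ([pairdens_ndecr], [pairdens_nonincr]).  For two weights
    the first point is [a s / b]; in general it is at least [(a - 1) s / b].

    The mode is located with calculus only.  Let [f] be the density of a sum of
    independent gamma variables of shapes [a k] and scales [th k], and [g k] the
    one obtained by raising the [k]-th shape by one.  Adding an exponential
    variable of mean [th k] to the [k]-th summand, and splitting the mean of the
    sum, give the two rules
      [th k * (g k)' = f - g k]   and   [x * f = \sum_k a k * th k * g k],
    which are all that is kept ([gamma_family]).  They imply
    [x * f' = (A - 1) * f - \sum_k a k * g k] with [A = \sum_k a k].  Signs are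
    propagated by the remark that [u + c * u' >= 0] with [c > 0] keeps [u]
    nonnegative once it is so ([relax_ge0]).
    - At a zero of [f'] which is a running maximum all defects [f - g k] are
      nonnegative, they satisfy [\sum_k a k * (f - g k) = f], and their sum with
      weights [a k * th k] is [(\sum_k a k * th k - x) * f]; as each
      [a k * (f - g k)] is at most [f], this gives
      [\sum_k (a k - 1) * th k <= x] ([gf_max_lb]).
    - Once [f' = 0] the density can only decrease ([gf_unimodal]), so an upper
      bound on the first zero of [f'] suffices for the last monotonicity.
    - That bound ([gf_mode_le]) compares the defects of the two raised indices
      with those of the others.  The latter are small because [g k], which is
      itself the density of such a sum, is increasing up to that zero and
      satisfies there a log-concavity inequality ([gf_log_concave]).

    Since the shape [a] may be small, [Phi] need not be smooth enough for
    differentiation along transfers.  The comparison is therefore made for the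
    increments of [K], where only subgradient inequalities are needed
    ([subgrad_path]), and [Phi] is recovered by sandwiching the increment of [K]
    over a small interval.  Vanishing weights are reached by letting
    [(1 - t) lam + t mu] tend to [lam]. *)

Import Order.TTheory GRing.Theory Num.Theory.
Import numFieldNormedType.Exports.

Local Open Scope classical_set_scope.
Local Open Scope ring_scope.

Set Implicit Arguments.
Unset Strict Implicit.
Unset Printing Implicit Defensive.

(** * Propagating signs through [u + c * u'] *)

Section relaxation.
Context {R : realType}.
Implicit Types (u v du : R -> R) (c a b x : R).

Lemma is_derive_lincomb n (c : 'I_n -> R) (h : 'I_n -> R -> R) (dh : 'I_n -> R) x :
  (forall k, is_derive x 1 (h k) (dh k)) ->
  is_derive x 1 (fun y => \sum_(k < n) c k * h k y) (\sum_(k < n) c k * dh k).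
Proof.
move=> hd.
rewrite (_ : (fun y => _) = \sum_(k < n) (c k \*: h k)); last first.
  by apply/funext => y; rewrite fct_sumE.
by apply: is_derive_sum.
Qed.

Lemma is_derive_relax u v (du dv c1 c2 c3 : R) x : is_derive x 1 u du -> is_derive x 1 v dv ->
  is_derive x 1 (fun y => (c1 * u y - c2 * v y) / c3) ((c1 * du - c2 * dv) / c3).
Proof.
move=> ud vd; have := is_deriveM (is_derive_cst c1 x 1) ud => H1.
have H2 := is_deriveM (is_derive_cst c2 x 1) vd.
have H := is_deriveM (is_deriveB H1 H2) (is_derive_cst c3^-1 x 1).
by apply: (is_derive_eq H); rewrite /GRing.scale/= !mulr0 !addr0 add0r mulrC.
Qed.

Lemma is_derive_continuous u x c : is_derive x 1 u c -> {for x, continuous u}.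
Proof.
by move=> [ud _]; apply: differentiable_continuous; apply/derivable1_diffP.
Qed.

(** [u + c * u'] is, up to a positive factor, the derivative of [expR (x / c) * u x];
    the mean value theorem for this product gives all the sign rules below. *)
Lemma MVT_relax u du c a b : 0 < c -> a < b ->
  {in `]a, b[, forall x, is_derive x 1 u (du x)} -> {within `[a, b], continuous u} ->
  exists2 y, y \in `]a, b[ & expR (b / c) * u b - expR (a / c) * u a =
    expR (y / c) / c * (u y + c * du y) * (b - a).
Proof.
move=> c0 ab ud uc.
pose v := fun x => expR (x / c) * u x.
apply: (@MVT _ v) => // [x xab|x].
  have H := ud x xab; apply: is_derive_eq.
  rewrite /GRing.scale/= mulr1 mulr0 add0r mulrDr addrC; congr (_ + _).
    by rewrite mulrC mulrAC.
  by field; rewrite gt_eqF.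
apply: cvgM; last exact: uc.
apply: continuous_subspaceT => {}x.
apply: (@continuous_comp _ _ _ (fun x => x / c) expR); last exact: continuous_expR.
by apply: cvgMl; exact: cvg_id.
Qed.

Lemma relax_ge0 u du c a b : 0 < c -> a <= b ->
  {in `]a, b[, forall x, is_derive x 1 u (du x)} -> {within `[a, b], continuous u} ->
  {in `]a, b[, forall x, 0 <= u x + c * du x} -> 0 <= u a -> 0 <= u b.
Proof.
move=> c0; rewrite le_eqVlt => /predU1P[->//|ab] ud uc ge0 ua.
have [y yab yE] := MVT_relax c0 ab ud uc.
rewrite -(pmulr_rge0 _ (expR_gt0 (b / c))) -(subrK (expR (a / c) * u a) (_ * _)) yE.
rewrite addr_ge0 ?mulr_ge0 ?subr_ge0 ?(ltW ab) ?expR_ge0 ?ge0//.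
by rewrite invr_ge0 ltW.
Qed.

Lemma relax_gt0 u du c a b : 0 < c -> a < b ->
  {in `]a, b[, forall x, is_derive x 1 u (du x)} -> {within `[a, b], continuous u} ->
  {in `]a, b[, forall x, 0 < u x + c * du x} -> 0 <= u a -> 0 < u b.
Proof.
move=> c0 ab ud uc ge0 ua.
have [y yab yE] := MVT_relax c0 ab ud uc.
rewrite -(pmulr_rgt0 _ (expR_gt0 (b / c))) -(subrK (expR (a / c) * u a) (_ * _)) yE.
by rewrite ltr_pwDl ?mulr_gt0 ?mulr_ge0 ?subr_gt0 ?ab ?expR_ge0 ?expR_gt0 ?ge0 ?invr_gt0.
Qed.

Lemma relax_pos u du c a b : 0 < c -> a <= b ->
  {in `]a, b[, forall x, is_derive x 1 u (du x)} -> {within `[a, b], continuous u} ->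
  {in `]a, b[, forall x, 0 <= u x + c * du x} -> 0 < u a -> 0 < u b.
Proof.
move=> c0; rewrite le_eqVlt => /predU1P[->//|ab] ud uc ge0 ua.
have [y yab yE] := MVT_relax c0 ab ud uc.
rewrite -(pmulr_rgt0 _ (expR_gt0 (b / c))) -(subrK (expR (a / c) * u a) (_ * _)) yE.
rewrite ltr_wpDl ?mulr_gt0 ?expR_gt0// ?mulr_ge0 ?subr_ge0 ?(ltW ab) ?expR_ge0 ?ge0//.
by rewrite invr_ge0 ltW.
Qed.

End relaxation.

(** * Densities of sums of independent gamma variables *)

(** What is retained of the density [f] of a sum of independent gamma variables of
    shapes [a k] and scales [th k]: [g k] is the density with the [k]-th shape raised
    by one, that is, with an extra exponential summand of mean [th k], hence
    [gf_raise]; and [a k * th k * g k x] is the contribution of the [k]-th summand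
    to [x * f x], hence [gf_moment]. *)
Record gamma_family {R : realType} (n : nat) (a th : 'I_n -> R) (f : R -> R)
    (g : 'I_n -> R -> R) : Prop := GammaFamily {
  gf_shape_gt0 : forall k, 0 < a k;
  gf_scale_gt0 : forall k, 0 < th k;
  gf_cont : continuous f;
  gf_eq0 : forall x : R, x <= 0 -> f x = 0;
  gf_gt0 : forall x : R, 0 < x -> 0 < f x;
  gf_raise0 : forall k (x : R), x <= 0 -> g k x = 0;
  gf_raise : forall k (x : R), is_derive x 1 (g k) ((f x - g k x) / th k);
  gf_moment : forall x : R, x * f x = \sum_(k < n) a k * th k * g k x }.

Lemma is_derive_lt0_right {R : realType} (u : R -> R) (x d : R) :
  is_derive x 1 u d -> d < 0 -> \forall y \near x^'+, u y < u x.
Proof.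
move=> [ud <-] d0.
have [e /= e0 eH] : \forall h \near (0:R)^', h^-1 * (u (h + x) - u x) < 0.
  have := ud; rewrite /derivable => /cvgr_lt /(_ _ d0).
  rewrite /= /GRing.scale/=.
  by apply: filterS => h; rewrite mulr1.
exists e => //= y; rewrite /ball/= => yxe xy.
have : (y - x)^-1 * (u (y - x + x) - u x) < 0.
  by apply: eH; rewrite /ball/= ?sub0r ?normrN 1?distrC// subr_eq0 gt_eqF.
by rewrite subrK pmulr_rlt0 ?invr_gt0 ?subr_gt0// subr_lt0.
Qed.

Section gamma_family.
Context {R : realType} (n : nat) (a th : 'I_n -> R) (f : R -> R) (g : 'I_n -> R -> R).
Hypothesis fam : gamma_family a th f g.
Let th0 := gf_scale_gt0 fam.
Let a0 := gf_shape_gt0 fam.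
Let f0 := gf_gt0 fam.

(** This is [x * f' x], see [gf_derive]; it is preferred to [f'] because it is linear in
    [f] and the [g k]. *)
Definition gf_slope (x : R) := (\sum_(k < n) a k - 1) * f x - \sum_(k < n) a k * g k x.
Local Notation G := gf_slope.

Lemma gf_raise_cont k : continuous (g k).
Proof. by move=> x; apply: is_derive_continuous (gf_raise fam k x). Qed.

(** At a critical point the defects [f - g k], weighted by the shapes, add up to [f]. *)
Lemma gf_slopeE x : \sum_(k < n) a k * (f x - g k x) = f x + G x.
Proof.
by under eq_bigr do rewrite mulrBr; rewrite sumrB -mulr_suml /G; ring.
Qed.

Lemma gf_meanE x : \sum_(k < n) a k * th k * (f x - g k x) =
  (\sum_(k < n) a k * th k - x) * f x.
Proof.
under eq_bigr do rewrite mulrBr; rewrite sumrB -mulr_suml -(gf_moment fam); ring.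
Qed.

Lemma gf_derive (x : R) : 0 < x -> is_derive x 1 f (G x / x).
Proof.
move=> x0.
pose S y := \sum_(k < n) a k * th k * g k y.
have SE y : S y = y * f y by rewrite (gf_moment fam).
have dS : is_derive x 1 S (\sum_(k < n) a k * th k * ((f x - g k x) / th k)).
  exact: (is_derive_lincomb (fun k => a k * th k) (fun k => gf_raise fam k x)).
have dV : is_derive x 1 (fun y : R => y^-1) (- x ^- 2).
  have := @is_deriveV R id x 1 1 (lt0r_neq0 x0) (is_derive_id _ _).
  by rewrite /GRing.scale/= mulr1.
apply: (@near_eq_is_derive R R^o R^o (fun y => y^-1 * S y) f).
  near=> y; rewrite SE mulKf// gt_eqF//; near: y.
  exact: lt_nbhsr.
apply: is_derive_eq.
rewrite /GRing.scale/= SE.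
under eq_bigr do rewrite mulrA (mulrAC (a _)) mulfK ?gt_eqF//.
by rewrite gf_slopeE; field; rewrite gt_eqF.
Unshelve. all: by end_near. Qed.

Lemma gf_slope_derive (x : R) : 0 < x -> is_derive x 1 G
  ((\sum_(k < n) a k - 1) * (G x / x) - \sum_(k < n) a k * ((f x - g k x) / th k)).
Proof.
move=> x0; have H := gf_derive x0.
have H1 : is_derive x 1 (fun y => \sum_(k < n) a k * g k y)
   (\sum_(k < n) a k * ((f x - g k x) / th k)).
  exact: (is_derive_lincomb a (fun k => gf_raise fam k x)).
exact: is_deriveB.
Qed.

Lemma gf_slope_cont (x : R) : 0 < x -> {for x, continuous G}.
Proof. by move=> x0; apply: is_derive_continuous (gf_slope_derive x0). Qed.

Lemma gf_raise_gt0 k x : 0 < x -> 0 < g k x.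
Proof.
move=> x0; apply: (@relax_gt0 _ _ (fun x => (f x - g k x) / th k) (th k) 0) => //.
- by move=> y _; exact: (gf_raise fam).
- exact/continuous_subspaceT/gf_raise_cont.
- move=> y; rewrite in_itv/= => /andP[y0 _].
  by rewrite mulrC divfK ?gt_eqF// addrC subrK f0.
- by rewrite (gf_raise0 fam).
Qed.

Definition gf_runmax x := forall y, 0 < y -> y < x -> f y <= f x.

(** [g k] follows [f] with a delay ([th k * (g k)' = f - g k]), so it cannot overtake the
    maximum of the values of [f] met so far. *)
Lemma gf_raise_le x k : 0 < x -> gf_runmax x -> 0 <= f x - g k x.
Proof.
move=> x0 mx; apply: (@relax_ge0 _ (fun y => f x - g k y)
   (fun y => - ((f y - g k y) / th k)) (th k) 0) => //.
- exact: ltW.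
- move=> y _; have H := is_deriveB (is_derive_cst (f x) y 1) (gf_raise fam k y); rewrite -[X in is_derive _ _ _ X]add0r; exact: H.
- apply: (@continuous_subspaceT R R _ (fun y => f x - g k y)) => y.
  by apply: cvgB; [exact: cvg_cst|exact: gf_raise_cont].
- move=> y; rewrite in_itv/= => /andP[y0 yx].
  by rewrite mulrN mulrC divfK ?gt_eqF// opprB addrA subrK subr_ge0 mx.
- by rewrite (gf_raise0 fam)// subr0 ltW ?f0.
Qed.

Lemma gf_raise_small x k : 0 < x -> gf_runmax x -> g k x <= x / th k * f x.
Proof.
move=> x0 mx.
have gc : {within `[0, x], continuous (g k)}.
  exact/continuous_subspaceT/gf_raise_cont.
have [y] := MVT x0 (fun y _ => gf_raise fam k y) gc.
rewrite in_itv/= (gf_raise0 fam k (lexx 0)) !subr0 => /andP[y0 yx] ->.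
rewrite [leRHS]mulrC mulrA mulrAC ler_pM2r ?invr_gt0// ler_pM2r//.
by rewrite lerBlDr (le_trans (mx _ y0 yx))// lerDl ltW// gf_raise_gt0.
Qed.

(** All defects are nonnegative at a running maximum, so each [a k * (f - g k)] is at
    most their sum, which is at most [f] where the slope is nonpositive.  Weighting by
    [th k] bounds the sum [\sum_k a k * th k * (f - g k) = (\sum_k a k * th k - x) * f]. *)
Lemma gf_max_lb x : 0 < x -> gf_runmax x -> G x <= 0 ->
  \sum_(k < n) (a k - 1) * th k <= x.
Proof.
move=> x0 mx Gx.
under eq_bigr do rewrite mulrBl mul1r.
rewrite sumrB lerBlDl -lerBlDr -(ler_pM2r (f0 x0)) -gf_meanE mulr_suml.
apply: ler_sum => k _.
rewrite mulrAC mulrC ler_pM2l//.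
apply: (@le_trans _ _ (f x + G x)); last by rewrite gerDl.
rewrite -gf_slopeE (bigD1 k)//= lerDl sumr_ge0// => j _.
by rewrite mulr_ge0 ?gf_raise_le// ltW.
Qed.

(** Near [0] the [g k] are negligible with respect to [f], so the sign of the slope is
    that of [A - 1] with [A] the sum of the shapes. *)
Lemma gf_slope_small x : 0 < x -> gf_runmax x ->
  (\sum_(k < n) a k - 1 - x * \sum_(k < n) a k / th k) * f x <= G x.
Proof.
move=> x0 mx; rewrite mulrBl lerD2l lerN2 mulr_sumr mulr_suml.
apply: ler_sum => k _.
rewrite mulrCA -mulrA ler_pM2l//; exact: gf_raise_small.
Qed.

(** If [f] failed to increase, its maximum over some segment would be reached at an
    interior point; there [f] has a running maximum and a vanishing slope. *)
Lemma gf_ndecr (B : R) :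
  (forall x, 0 < x -> x < B -> gf_runmax x -> G x != 0) ->
  forall x y, 0 <= x -> x <= y -> y <= B -> f x <= f y.
Proof.
move=> H x y x0 xy yB.
have [y0|y0] := leP y 0.
  by rewrite (gf_eq0 fam) ?(le_trans xy)// (gf_eq0 fam).
have [] := @EVT_max _ f 0 y (ltW y0); first exact/continuous_subspaceT/(gf_cont fam).
move=> c; rewrite in_itv/= => /andP[c0 cy] cmax.
have xyi : x \in `[0, y] by rewrite in_itv/= x0.
have [cy'|] := ltP c y; last first.
  by move=> yc; rewrite (_ : y = c) ?cmax//; apply/eqP; rewrite eq_le yc cy.
have c0' : 0 < c.
  rewrite lt_neqAle c0 andbT; apply/negP => /eqP c0'.
  have := cmax y; rewrite in_itv/= lexx (ltW y0) => /(_ isT).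
  by rewrite -c0' (gf_eq0 fam (lexx 0)) leNgt f0.
have : G c != 0.
  apply: H => //; first exact: lt_le_trans yB.
  by move=> t c0t tc; apply: cmax; rewrite in_itv/= (ltW c0t)/= (le_trans (ltW tc)).
move=> /negP; case; apply/eqP.
suff : is_derive c 1 f 0.
  move=> [_ E]; have [_] := gf_derive c0'; rewrite E => /esym/eqP.
  by rewrite mulf_eq0 invr_eq0 (gt_eqF c0') orbF => /eqP.
apply: (@derive1_at_max _ _ 0 y); rewrite ?in_itv/= ?c0' ?(ltW y0)//.
  by move=> t; rewrite in_itv/= => /andP[t0 _]; have [] := gf_derive t0.
move=> t; rewrite in_itv/= => /andP[t0 ty].
by apply: cmax; rewrite in_itv/= (ltW t0)/= (ltW ty).
Qed.

Lemma gf_ndecr_below x y : 0 <= x -> x <= y -> y <= \sum_(k < n) (a k - 1) * th k ->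
  f x <= f y.
Proof.
apply: gf_ndecr => t t0 tB mt; apply/negP => /eqP Gt.
by move: tB; rewrite ltNge gf_max_lb// Gt.
Qed.

End gamma_family.

(** * The first critical point and log-concavity before it *)

Section gamma_family_mode.
Context {R : realType} (n : nat) (a th : 'I_n -> R) (f : R -> R) (g : 'I_n -> R -> R).
Hypothesis fam : gamma_family a th f g.
Hypothesis A1 : 1 < \sum_(k < n) a k.
Let th0 := gf_scale_gt0 fam.
Let a0 := gf_shape_gt0 fam.
Let f0 := gf_gt0 fam.
Local Notation G := (gf_slope a f g).

Lemma gf_slope_gt0_near0 : exists2 e : R, 0 < e & forall x, 0 < x -> x < e ->
  gf_runmax f x /\ 0 < G x.
Proof.
pose B := \sum_(k < n) a k / th k.
have B0 : 0 <= B by apply: sumr_ge0 => k _; rewrite divr_ge0 ?ltW.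
have B1 : 0 < B + 1 by rewrite ltr_wpDl.
have Ax x : 0 < x -> x < (\sum_(k < n) a k - 1) / (B + 1) ->
    gf_runmax f x -> 0 < G x.
  move=> x0 xe mx; apply: lt_le_trans (gf_slope_small fam x0 mx).
  rewrite mulr_gt0 ?f0// subr_gt0.
  move: xe; rewrite ltr_pdivlMr// -/B; apply: le_lt_trans.
  by rewrite ler_pM2l// lerDl.
exists ((\sum_(k < n) a k - 1) / (B + 1)).
  by rewrite divr_gt0// subr_gt0.
move=> x x0 xe.
have mx : gf_runmax f x.
  move=> y y0 yx; apply: (gf_ndecr fam _ (ltW y0) (ltW yx) (ltW xe)).
  by move=> t t0 te mt; rewrite gt_eqF ?Ax.
by split=> //; apply: Ax.
Qed.

Lemma gf_lt z : (forall x, 0 < x -> x < z -> 0 < G x) ->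
  forall x y, 0 <= x -> x < y -> y <= z -> f x < f y.
Proof.
move=> Gz x y x0 xy yz; have fc : {within `[x, y], continuous f}.
  exact/continuous_subspaceT/(gf_cont fam).
have fd t : t \in `]x, y[ -> is_derive t 1 f (G t / t).
  by rewrite in_itv/= => /andP[xt _]; apply: (gf_derive fam); exact: le_lt_trans xt.
have [t] := MVT xy fd fc.
rewrite in_itv/= => /andP[xt ty] E.
have t0 : 0 < t by exact: le_lt_trans xt.
by rewrite -subr_gt0 E mulr_gt0 ?subr_gt0// divr_gt0// Gz// (lt_le_trans ty).
Qed.

Lemma gf_runmax_slope z : (forall x, 0 < x -> x < z -> 0 < G x) ->
  forall x, 0 < x -> x <= z -> gf_runmax f x.
Proof. by move=> Gz x x0 xz y y0 yx; apply/ltW/(gf_lt Gz) => //; apply: ltW. Qed.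

(** The slope is positive near [0] but cannot stay so past the mean
    [\sum_k a k * th k]: there [gf_meanE] would make a sum of nonnegative defects
    negative. *)
Lemma gf_first_zero : exists x1, [/\ 0 < x1, G x1 = 0 &
  forall x, 0 < x -> x < x1 -> 0 < G x].
Proof.
pose S := [set x : R | 0 < x /\ G x <= 0].
have [e e0 eG] := gf_slope_gt0_near0.
have Slb : lbound S e.
  by move=> x [x0]; rewrite leNgt => Gx; rewrite leNgt; apply: contra Gx => /eG[].
have S0 : S !=set0.
  apply: contrapT => /set0P/negP; rewrite negbK => /eqP S0.
  have Gp x : 0 < x -> 0 < G x.
    by move=> x0; rewrite ltNge; apply/negP => Gx; have : S x by []; rewrite S0.
  pose m := \sum_(k < n) a k * th k.
  have m0 : 0 < m + 1.
    by rewrite ltr_wpDl// sumr_ge0// => k _; rewrite mulr_ge0 ?ltW.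
  have := gf_meanE fam (m + 1).
  rewrite -/m opprD addrA subrr add0r mulN1r => /eqP; rewrite gt_eqF//.
  apply: (@lt_le_trans _ _ 0); first by rewrite oppr_lt0 f0.
  apply: sumr_ge0 => k _; apply: mulr_ge0; first by rewrite mulr_ge0// ltW.
  apply: (gf_raise_le fam) => //.
  by apply: (@gf_runmax_slope (m + 1)) => // x x0 _; exact: Gp.
have Sinf : has_inf S by split=> //; exists e.
exists (inf S).
have ei : e <= inf S by exact: lb_le_inf.
have i0 : 0 < inf S by exact: lt_le_trans ei.
have Gp x : 0 < x -> x < inf S -> 0 < G x.
  move=> x0 xi; rewrite ltNge; apply/negP => Gx.
  by move: xi; rewrite ltNge ge_inf//; exists e.
split=> //.
have Gc := gf_slope_cont fam i0.
apply/eqP; rewrite eq_le; apply/andP; split; rewrite leNgt; apply/negP => Gi.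
- have /= [d d0 dH] : \forall y \near inf S, 0 < G y.
    by apply: (cvgr_gt _ Gc).
  have [y Sy yi] := inf_adherent d0 Sinf.
  have iy : inf S <= y by apply: ge_inf => //; exists e.
  have : 0 < G y by apply: dH; rewrite /= distrC ger0_norm ?subr_ge0// ltrBlDl.
  by rewrite ltNge; case: Sy => _ ->.
- have /= [d d0 dH] : \forall y \near inf S, G y < 0.
    by apply: (cvgr_lt _ Gc).
  pose y := Num.max (inf S / 2) (inf S - d / 2).
  have {}d0 : (0 : R) < d by [].
  have yi : y < inf S.
    by rewrite gt_max; apply/andP; split; lra.
  have y0 : 0 < y by rewrite lt_max divr_gt0.
  have : G y < 0.
    apply: dH; rewrite /= gtr0_norm ?subr_gt0// ltrBlDl -ltrBlDr.
    by rewrite lt_max; apply/orP; right; lra.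
  by rewrite ltNge ltW// Gp.
Qed.

(** The inequality says [(g k)' / g k >= f' / f], with [f'] written as slope over [x].
    Let [y] minimize [r = f' / f] over [(0, z]].  Then [f' - r y * f >= 0] up to [y], and
    [relax_ge0] transfers this to [(g k)' - r y * g k], which is the claim at [y].
    If [y < z], then [h = x * f' - r y * x * f] has an interior minimum at [y], whereas
    these inequalities make its derivative negative; so [y = z]. *)
Lemma gf_log_concave z : 0 < z -> (forall x, 0 < x -> x <= z -> 0 < G x) ->
  forall k, G z / z * g k z <= (f z - g k z) / th k * f z.
Proof.
move=> z0 Gz.
pose r x := G x / (x * f x).
have r0 x : 0 < x -> x <= z -> 0 < r x.
  by move=> x0 xz; rewrite /r divr_gt0 ?mulr_gt0 ?Gz ?f0.
have Gr x : 0 < x -> G x = r x * x * f x.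
  by move=> x0; rewrite /r -mulrA divfK// gt_eqF// mulr_gt0 ?f0.
have mz x : 0 < x -> x <= z -> gf_runmax f x.
  by apply: gf_runmax_slope => x' x0' xz'; apply: Gz => //; exact: ltW.
have [y [y0 yz ry]] : exists y, [/\ 0 < y, y <= z & forall x, 0 < x -> x <= z -> r y <= r x].
  pose B := \sum_(k < n) a k / th k.
  have B0 : 0 <= B by apply: sumr_ge0 => k _; rewrite divr_ge0 ?ltW.
  pose e := Num.min z ((\sum_(k < n) a k - 1) / (r z + B)).
  have rB0 : 0 < r z + B by rewrite ltr_wpDr ?r0.
  have e0 : 0 < e by rewrite lt_min z0 divr_gt0// subr_gt0.
  have ez : e <= z by rewrite ge_min lexx.
  have re x : 0 < x -> x <= e -> r z <= r x.
    move=> x0 xe; have xz : x <= z by exact: le_trans ez.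
    rewrite [r x]/r ler_pdivlMr ?mulr_gt0 ?f0//.
    apply: le_trans (gf_slope_small fam x0 (mz _ x0 xz)).
    rewrite mulrA ler_pM2r ?f0// lerBrDr -/B mulrC -mulrDr -ler_pdivlMr//.
    by rewrite (le_trans xe)// /e ge_min lexx orbT.
  have rc : {within `[e, z], continuous r}.
    apply: derivable_within_continuous => x; rewrite in_itv/= => /andP[ex xz].
    have x0 : 0 < x by exact: lt_le_trans ex.
    have H1 := gf_slope_derive fam x0.
    have H2 := gf_derive fam x0.
    have xf : x * f x != 0 by rewrite gt_eqF// mulr_gt0 ?f0.
    have H3 := is_deriveM (is_derive_id x 1) H2.
    have H4 := @is_deriveV _ (fun x => x * f x) _ _ _ xf H3.
    by have [] := is_deriveM H1 H4.
  have [y] := EVT_min ez rc.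
  rewrite in_itv/= => /andP[ey yz] ymin; exists y; split=> //.
    exact: lt_le_trans ey.
  move=> x x0 xz; have [ex|xe] := leP e x.
    by apply: ymin; rewrite in_itv/= ex.
  apply: (@le_trans _ _ (r z)); last exact/re/ltW.
  by apply: ymin; rewrite in_itv/= ez lexx.
pose rho := r y.
have rho0 : 0 < rho by exact: r0.
have key k : rho * g k y <= (f y - g k y) / th k.
  pose u x := (f x - g k x) / th k - rho * g k x.
  pose du x := (G x / x - (f x - g k x) / th k) / th k - rho * ((f x - g k x) / th k).
  rewrite -subr_ge0 -/(u y).
  apply: (@relax_ge0 _ u du (th k) 0) => //.
  - exact: ltW.
  - move=> x; rewrite in_itv/= => /andP[x0 _].
    have H := gf_derive fam x0; have H2 := gf_raise fam k x.
    apply: is_derive_eq; rewrite /GRing.scale/= mulr0 add0r; congr (_ - _).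
    by rewrite mulrC.
  - apply: (@continuous_subspaceT R R _ u) => x.
    apply: cvgB; first apply: cvgMl; first apply: cvgB.
    + exact: (gf_cont fam).
    + exact: (gf_raise_cont fam).
    + by apply: cvgMr; exact: (gf_raise_cont fam).
  - move=> x; rewrite in_itv/= => /andP[x0 xy].
    have -> : u x + th k * du x = G x / x - rho * f x.
      by rewrite /u /du; field; rewrite !gt_eqF.
    rewrite (Gr x)// mulrAC mulfK ?gt_eqF// -mulrBl.
    apply: mulr_ge0; last exact/ltW/f0.
    by rewrite subr_ge0 ry// ltW// (lt_le_trans xy).
  - by rewrite /u (gf_raise0 fam k (lexx 0)) (gf_eq0 fam (lexx 0)) subrr mul0r mulr0 subrr.
have yz' : y = z.
  apply/eqP; rewrite eq_le yz/= leNgt; apply/negP => ltyz.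
  have [h hE] : exists h : R -> R, h = fun x => G x - rho * (x * f x) by eexists.
  have dh (x : R) : 0 < x -> is_derive x 1 h
    (((\sum_(k < n) a k - 1) * (G x / x) - \sum_(k < n) a k * ((f x - g k x) / th k))
      - rho * (x * (G x / x) + f x)).
    move=> x0; have H1 := gf_slope_derive fam x0; have H2 := gf_derive fam x0.
    by rewrite hE; apply: is_derive_eq; rewrite /GRing.scale/= mulr1.
  have : is_derive y 1 h 0.
    apply: (@derive1_at_min _ h 0 z y); rewrite ?in_itv/= ?y0 ?(ltW z0)//.
      by move=> t; rewrite in_itv/= => /andP[t0 _]; have [] := dh _ t0.
    move=> t; rewrite in_itv/= => /andP[t0 tz].
    rewrite hE (Gr y)// -/rho -mulrA subrr (Gr t)// -mulrA -mulrBl.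
    apply: mulr_ge0; last by rewrite mulr_ge0 ?ltW ?f0.
    by rewrite subr_ge0 ry// ltW.
  move=> [_ E]; have [_] := dh _ y0; rewrite E => /esym/eqP; apply/negP.
  rewrite lt_eqF// (Gr y)// -/rho.
  have -> : rho * y * f y / y = rho * f y by field; rewrite gt_eqF.
  have H : rho * \sum_(k < n) a k * g k y <= \sum_(k < n) a k * ((f y - g k y) / th k).
    by rewrite mulr_sumr; apply: ler_sum => k _; rewrite mulrCA ler_pM2l.
  have GE : (\sum_(k < n) a k - 1) * f y - \sum_(k < n) a k * g k y = rho * y * f y.
    by rewrite -Gr.
  have rf : 0 < rho * f y by rewrite mulr_gt0 ?f0.
  set s1 := \sum_(k < n) _ * (_ / _) in H *.
  set s2 := \sum_(k < n) _ * g _ _ in H GE *.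
  set A := \sum_(k < n) a k in GE *.
  have -> : (A - 1) * (rho * f y) - s1 - rho * (y * (rho * f y) + f y) =
     rho * ((A - 1) * f y - s2 - rho * y * f y) - rho * f y + (rho * s2 - s1) by ring.
  by rewrite GE subrr mulr0 add0r; lra.
rewrite -yz' => k; rewrite (Gr y)//.
have -> : r y * y * f y / y = r y * f y by field; rewrite gt_eqF.
by rewrite mulrAC ler_pM2r ?f0// key.
Qed.

End gamma_family_mode.

(** * Unimodality *)

Lemma sumr_gt0 {R : numDomainType} n (F : 'I_n -> R) k :
  (forall j, 0 <= F j) -> 0 < F k -> 0 < \sum_(j < n) F j.
Proof. by move=> F0 Fk; rewrite (bigD1 k)//= ltr_pwDl// sumr_ge0. Qed.

Section gamma_family_unimodal.
Context {R : realType} (n : nat) (a th : 'I_n -> R) (f : R -> R) (g : 'I_n -> R -> R).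
Hypothesis fam : gamma_family a th f g.
Hypothesis A1 : 1 < \sum_(k < n) a k.
Let th0 := gf_scale_gt0 fam.
Let a0 := gf_shape_gt0 fam.
Let f0 := gf_gt0 fam.
Local Notation G := (gf_slope a f g).

(** Suppose the slope is positive at some [z > x1].  It vanishes at [x1] with a negative
    derivative, so [f] drops after [x1] and has an interior minimum [c] in [(x1, z)],
    which is a second critical point.  As [g k] relaxes towards values of [f] that are
    at least [f c], the ratio [g k / f] is larger at [c] than at [x1] for every [k]; but
    at a critical point [\sum_k a k * g k = (A - 1) * f], so the ratios cannot all
    increase. *)
Lemma gf_unimodal (x1 : R) : 0 < x1 -> G x1 = 0 -> (forall x, 0 < x -> x < x1 -> 0 < G x) ->
  forall x, x1 <= x -> G x <= 0.
Proof.
move=> x10 Gx1 Gpos z x1z; rewrite leNgt; apply/negP => Gz.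
have {}x1z : x1 < z.
  by rewrite lt_neqAle x1z andbT; apply: contraTneq Gz => <-; rewrite Gx1 ltxx.
have mx1 : gf_runmax f x1 by exact: (gf_runmax_slope fam Gpos).
have d0 k : 0 <= f x1 - g k x1 by exact: (gf_raise_le fam).
(* The derivative of the slope is here [- \sum_k a k * (f - g k) / th k]; the defects are
   nonnegative and, as [\sum_k a k * (f - g k) = f > 0], not all zero. *)
have drop : \forall y \near x1^'+, G y < G x1.
  apply: is_derive_lt0_right (gf_slope_derive fam x10) _.
  rewrite Gx1 mul0r mulr0 sub0r oppr_lt0.
  have [k dk] : exists k, 0 < f x1 - g k x1.
    apply: contrapT => /forallNP d_le0.
    have := gf_slopeE a f g x1; rewrite Gx1 addr0 big1 => [/eqP|k _].
      by rewrite lt_eqF ?f0.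
    apply/eqP; rewrite mulf_eq0 (gt_eqF (a0 k))/= eq_le d0 andbT leNgt.
    exact/negP/d_le0.
  apply: (@sumr_gt0 _ _ _ k) => [j|]; last by rewrite mulr_gt0 ?divr_gt0.
  by rewrite mulr_ge0 ?divr_ge0 // ltW.
have [e /= e0 eG] : \forall y \near x1^'+, G y < 0.
  by move: drop; apply: filterS => y; rewrite Gx1.
have fcont x y : {within `[x, y], continuous f}.
  exact/continuous_subspaceT/(gf_cont fam).
have fd (x y : R) : 0 < x -> {in `]x, y[, forall t : R, is_derive t 1 f (G t / t)}.
  by move=> x0 t; rewrite in_itv/= => /andP[xt _]; apply: (gf_derive fam); exact: lt_trans xt.
have [c] := EVT_min (ltW x1z) (fcont x1 z).
rewrite in_itv/= => /andP[x1c cz] cmin.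
have fc1 : f c < f x1.
  pose y := Num.min z (x1 + e / 2).
  have {}e0 : (0 : R) < e by [].
  have x1y : x1 < y by rewrite lt_min x1z ltrDl divr_gt0.
  have yz : y <= z by rewrite ge_min lexx.
  have ye : y < x1 + e.
    rewrite gt_min; apply/orP; right; rewrite ltrD2l.
    by rewrite ltr_pdivrMr// ltr_pMr// ltr1n.
  apply: (@le_lt_trans _ _ (f y)).
    by apply: cmin; rewrite in_itv/= yz ltW.
  have [t] := MVT x1y (fd _ y x10) (fcont x1 y).
  rewrite in_itv/= => /andP[x1t ty] E.
  rewrite -subr_lt0 E pmulr_llt0 ?subr_gt0// pmulr_llt0 ?invr_gt0 ?(lt_trans x10)//.
  apply: eG => //=; rewrite distrC gtr0_norm ?subr_gt0// ltrBlDl.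
  exact: lt_trans ye.
have x1c' : x1 < c.
  by rewrite lt_neqAle x1c andbT; apply: contraTneq fc1 => ->; rewrite ltxx.
have c0 : 0 < c by exact: lt_trans x1c'.
have z0 : 0 < z by exact: lt_trans x1z.
have cz' : c < z.
  rewrite lt_neqAle cz andbT; apply/negP => /eqP {cz}cz.
  have /= [d d0' dH] : \forall y \near z, 0 < G y.
    exact: (cvgr_gt _ (gf_slope_cont fam z0)).
  have {}d0' : (0 : R) < d by [].
  pose y := Num.max x1 (z - d / 2).
  have yz : y < z by rewrite gt_max x1z/= ltrBlDr ltrDl divr_gt0.
  have x1y : x1 <= y by rewrite le_max lexx.
  have y0 : 0 < y by exact: lt_le_trans x1y.
  have [t] := MVT yz (fd _ z y0) (fcont y z).
  rewrite in_itv/= => /andP[yt tz] E.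
  have : f z <= f y by rewrite -cz; apply: cmin; rewrite in_itv/= x1y ltW.
  apply/negP; rewrite -ltNge -subr_gt0 E.
  rewrite mulr_gt0 ?subr_gt0// divr_gt0 ?(lt_trans y0 yt)//.
  apply: dH; rewrite /= gtr0_norm ?subr_gt0// ltrBlDl -ltrBlDr.
  apply: lt_trans yt; rewrite lt_max; apply/orP; right.
  by rewrite ltrD2l ltrN2 ltr_pdivrMr// ltr_pMr// ltr1n.
have Gc : G c = 0.
  suff : is_derive c 1 f 0.
    move=> [_ E]; have [_] := gf_derive fam c0; rewrite E => /esym/eqP.
    by rewrite mulf_eq0 invr_eq0 (gt_eqF c0) orbF => /eqP.
  apply: (@derive1_at_min _ _ x1 z); rewrite ?in_itv/= ?x1c' ?(ltW x1z)//.
    by move=> t /(fd _ _ x10)[].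
  by move=> t tx; apply: cmin; apply: subset_itv_oo_cc.
pose q k := g k x1 / f x1.
have gq k : g k x1 = q k * f x1 by rewrite /q divfK// gt_eqF// f0.
have q1 k : q k <= 1 by rewrite ler_pdivrMr ?f0// mul1r -subr_ge0.
have q0 k : 0 < q k by rewrite divr_gt0 ?f0// (gf_raise_gt0 fam).
have gc k : q k * f c < g k c.
  rewrite -subr_gt0.
  apply: (@relax_pos _ (fun x => g k x - q k * f c) (fun x => (f x - g k x) / th k) (th k) x1) => //.
  - move=> x _; have := is_deriveB (gf_raise fam k x) (is_derive_cst (q k * f c) x 1).
    by rewrite subr0; exact.
  - apply: (@continuous_subspaceT R R _ (fun x => g k x - q k * f c)) => x.
    by apply: cvgB; [exact: (gf_raise_cont fam)|exact: cvg_cst].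
  - move=> x; rewrite in_itv/= => /andP[x1x xc].
    rewrite [th k * _]mulrC divfK ?gt_eqF// addrC -addrA addKr subr_ge0.
    apply: (@le_trans _ _ (f c)); first by rewrite ler_piMl// ltW ?f0.
    by apply: cmin; rewrite in_itv/= ltW//= ltW// (lt_trans xc).
  - by rewrite gq -mulrBr mulr_gt0// subr_gt0.
have sum0 : \sum_(k < n) a k * (g k c - q k * f c) = 0.
  under eq_bigr do rewrite mulrBr mulrA.
  rewrite sumrB -mulr_suml.
  have -> : \sum_(k < n) a k * g k c = (\sum_(k < n) a k - 1) * f c.
    by apply/esym/eqP; rewrite -subr_eq0; apply/eqP.
  have -> : \sum_(k < n) a k * q k = \sum_(k < n) a k - 1.
    have fx1 : f x1 != 0 by rewrite gt_eqF ?f0.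
    apply: (mulIf fx1); rewrite mulr_suml.
    under eq_bigr do rewrite -mulrA -gq.
    by apply/esym/eqP; rewrite -subr_eq0; apply/eqP.
  by rewrite subrr.
have k : 'I_n.
  by case: n a A1 => [a'|m _ _]; [rewrite big_ord0 ltr10|exact: ord0].
suff : 0 < \sum_(k < n) a k * (g k c - q k * f c) by rewrite sum0 ltxx.
by apply: (@sumr_gt0 _ _ _ k) => [j|]; [apply: ltW|]; rewrite mulr_gt0// subr_gt0.
Qed.

End gamma_family_unimodal.

(** * Mode of a density with two raised shapes *)

Definition pair_shape {R : realType} n (al : R) (i j k : 'I_n) : R :=
  al + (k == i)%:R + (k == j)%:R.

Section mode_bound.
Context {R : realType} (n : nat) (al : R) (i j : 'I_n) (th : 'I_n -> R) (f : R -> R) (g : 'I_n -> R -> R).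
Hypotheses (al0 : 0 < al) (ij : i != j).
Local Notation a := (pair_shape al i j).
Hypothesis fam : gamma_family a th f g.
Hypothesis fam2 : forall k, exists h,
  gamma_family (fun m => a m + (m == k)%:R) th (g k) h.
Let th0 := gf_scale_gt0 fam.
Let f0 := gf_gt0 fam.
Local Notation G := (gf_slope a f g).
Let s := \sum_(k < n) th k.

Lemma big_shape (F : 'I_n -> R) :
  \sum_(k < n) a k * F k = al * \sum_(k < n) F k + F i + F j.
Proof.
rewrite /pair_shape; under eq_bigr do rewrite !mulrDl.
rewrite !big_split/= -mulr_sumr; congr (_ + _ + _).
  rewrite (bigD1 i)//= eqxx mul1r big1 ?addr0// => k /negPf ->.
  by rewrite mul0r.
rewrite (bigD1 j)//= eqxx mul1r big1 ?addr0// => k /negPf ->.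
by rewrite mul0r.
Qed.

Lemma sum_shape : \sum_(k < n) a k = al *+ n + 1 + 1.
Proof.
transitivity (\sum_(k < n) a k * 1); first by apply: eq_bigr => k; rewrite mulr1.
by rewrite big_shape sumr_const card_ord mulr_natr.
Qed.

Lemma sum_shape_gt1 : 1 < \sum_(k < n) a k.
Proof. by rewrite sum_shape -addrA ltr_wpDl ?mulrn_wge0 ?ltW// ltrDl. Qed.

Lemma bigD2 (F : 'I_n -> R) :
  \sum_(k < n) F k = F i + F j + \sum_(k < n | (k != i) && (k != j)) F k.
Proof. by rewrite (bigD1 i)//= (bigD1 j) ?(eq_sym j)//= addrA. Qed.

Section mode.
Variable x1 : R.
Hypotheses (x10 : 0 < x1) (Gx1 : G x1 = 0)
  (Gpos : forall x : R, 0 < x -> x < x1 -> 0 < G x).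
Hypothesis thij : th j <= th i.

Let d k := f x1 - g k x1.

(** The defect [u = f - g k] satisfies [u + th k * u' = th k * f'], which is positive
    before the first critical point. *)
Lemma raise_lt k x : 0 < x -> x <= x1 -> 0 < f x - g k x.
Proof.
move=> xgt0 xx1.
apply: (@relax_gt0 _ (fun y => f y - g k y)
   (fun y => G y / y - (f y - g k y) / th k) (th k) 0) => //.
- move=> y; rewrite in_itv/= => /andP[y0 _].
  exact: (is_deriveB (gf_derive fam y0) (gf_raise fam k y)).
- apply: (@continuous_subspaceT R R _ (fun y => f y - g k y)) => y.
  by apply: cvgB; [exact: (gf_cont fam)|exact: (gf_raise_cont fam)].
- move=> y; rewrite in_itv/= => /andP[y0 yx].
  rewrite mulrBr addrC [X in _ - X]mulrC divfK ?gt_eqF// subrK.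
  by rewrite mulr_gt0 ?divr_gt0 ?Gpos// (lt_le_trans yx).
- by rewrite (gf_eq0 fam (lexx 0)) (gf_raise0 fam k (lexx 0)) subrr.
Qed.

(** The longer the scale, the longer the delay of [g k] behind the increasing [f]. *)
Lemma defect_le : d j <= d i.
Proof.
rewrite /d lerD2l lerN2 -subr_ge0.
apply: (@relax_ge0 _ (fun y => g j y - g i y)
   (fun y => (f y - g j y) / th j - (f y - g i y) / th i) (th j) 0) => //.
- exact: ltW.
- by move=> y _; exact: (is_deriveB (gf_raise fam j y) (gf_raise fam i y)).
- apply: (@continuous_subspaceT R R _ (fun y => g j y - g i y)) => y.
  by apply: cvgB; exact: (gf_raise_cont fam).
- move=> y; rewrite in_itv/= => /andP[y0 yx].
  have -> : g j y - g i y + th j * ((f y - g j y) / th j - (f y - g i y) / th i) =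
     (f y - g i y) * (1 - th j / th i) by field; rewrite !gt_eqF.
  rewrite mulr_ge0 ?subr_ge0 ?ler_pdivrMr ?mul1r//.
  by rewrite -subr_ge0 ltW// raise_lt// ltW.
- by rewrite !(gf_raise0 fam _ (lexx 0)) subrr.
Qed.

(** To be refuted: the first critical point lies beyond the claimed bound on the mode. *)
Hypothesis x1_gt : (al + 2^-1) * s < x1.

(** [F = g k] is again a density of the same kind, with the [k]-th shape raised, and is
    increasing up to [x1]; [D m] are its defects and [p] its derivative at [x1].
    Log-concavity bounds each [D m] below in terms of [p], while their weighted sum is
    [Delta * F] with [Delta] small because [x1] is large; keeping only the terms [i] and
    [j] of that sum yields an upper bound on [p], that is, on the defect
    [d k = th k * p]. *)
Lemma defect_small k : k != i -> k != j ->
  al * d k * (th i + th j - 2 * th k) <= th k * f x1.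
Proof.
move=> ki kj.
have [h famF] := fam2 k.
set aF := (fun m => _) in famF.
have AF : 1 < \sum_(m < n) aF m.
  apply: (lt_trans sum_shape_gt1); rewrite /aF [ltRHS]big_split/= ltrDl.
  by rewrite (bigD1 k)//= eqxx ltr_pwDl// sumr_ge0.
set F := g k x1 in famF *.
pose p := d k / th k.
have dk0 : 0 < d k by rewrite /d raise_lt.
have p0 : 0 < p by rewrite divr_gt0.
have F0 : 0 < F by exact: (gf_raise_gt0 fam).
have slopeF x : 0 < x -> gf_slope aF (g k) h x / x = (f x - g k x) / th k.
  move=> x0; have [_ <-] := gf_derive famF x0.
  by have [_ <-] := gf_raise fam k x.
have slopeF0 x : 0 < x -> x <= x1 -> 0 < gf_slope aF (g k) h x.
  move=> x0 xx1; rewrite -[X in _ < X](divfK (lt0r_neq0 x0)) slopeF//.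
  by rewrite mulr_gt0// divr_gt0// raise_lt.
pose D m := F - h m x1.
have D0 m : 0 <= D m.
  apply: (gf_raise_le famF) => //.
  by apply: (gf_runmax_slope famF (z := x1)) => // x x0 xx1; apply: slopeF0 => //; apply: ltW.
have pD m : p * th m * (F - D m) <= D m * F.
  have := gf_log_concave famF AF x10 slopeF0 m; rewrite slopeF// -/F -/(d k) -/p -/(D m).
  rewrite [leRHS]mulrAC ler_pdivlMr// => H.
  have -> : F - D m = h m x1 by rewrite /D opprB addrC subrK.
  by rewrite [leLHS]mulrAC.
pose Delta := al * s + th i + th j + th k - x1.
have DE : \sum_(m < n) aF m * th m * D m = Delta * F.
  rewrite (gf_meanE famF) -/F; congr ((_ - _) * _).
  under eq_bigr do rewrite /aF mulrDl.
  rewrite [LHS]big_split/= big_shape; congr (_ + _).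
  rewrite (bigD1 k)//= eqxx mul1r big1 ?addr0// => m /negPf ->.
  by rewrite mul0r.
have Dij : (al + 1) * (th i * D i + th j * D j) <= Delta * F.
  rewrite -DE bigD2.
  have -> : aF i = al + 1 by rewrite /aF /pair_shape eqxx (negPf ij) eq_sym (negPf ki) !addr0.
  have -> : aF j = al + 1.
    by rewrite /aF /pair_shape eqxx eq_sym (negPf ij) eq_sym (negPf kj) !addr0.
  rewrite mulrDr !mulrA lerDl; apply: sumr_ge0 => m _.
  apply: mulr_ge0 => //; apply: mulr_ge0; last exact: ltW.
  exact/ltW/(gf_shape_gt0 famF).
have sk : th i + th j + th k <= s.
  rewrite /s bigD2 lerD2l (bigD1 k) ?ki//= lerDl.
  by apply: sumr_ge0 => m _; exact: ltW.
have DeltaL : Delta <= (th i + th j + th k) / 2.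
  by move: x1_gt sk; rewrite /Delta; lra.
have := pD i; have := pD j; have := D0 i; have := D0 j.
have fF : f x1 = F + th k * p by rewrite /p /d mulrC divfK ?gt_eqF// -/F; ring.
have -> : d k = th k * p by rewrite /p mulrC divfK// gt_eqF.
rewrite fF.
have ti := th0 i; have tj := th0 j; have tk := th0 k.
clearbody p F Delta; move: (D i) (D j) Dij => Di Dj Dij Dj0 Di0 pDj pDi.
set L := th i + th j in DeltaL *.
pose B := (al + 1) * (th i ^+ 2 + th j ^+ 2) - th i * Delta.
have H1 : p * B <= Delta * F.
  rewrite -(ler_pM2r F0).
  have E1 : p * th i ^+ 2 * (F - Di) <= th i * Di * F.
    have -> : p * th i ^+ 2 * (F - Di) = th i * (p * th i * (F - Di)) by ring.
    by rewrite -[leRHS]mulrA ler_pM2l.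
  have E2 : p * th j ^+ 2 * (F - Dj) <= th j * Dj * F.
    have -> : p * th j ^+ 2 * (F - Dj) = th j * (p * th j * (F - Dj)) by ring.
    by rewrite -[leRHS]mulrA ler_pM2l.
  have E3 : (al + 1) * (th i ^+ 2 * Di + th j ^+ 2 * Dj) <= th i * (Delta * F).
    apply: le_trans (ler_wpM2l (ltW ti) Dij).
    rewrite -subr_ge0 (_ : _ - _ = (al + 1) * (th j * Dj * (th i - th j))); last by ring.
    by rewrite mulr_ge0 ?addr_ge0 ?(ltW al0)// mulr_ge0 ?subr_ge0// mulr_ge0// ltW.
  have E4 : p * ((al + 1) * (th i ^+ 2 * Di + th j ^+ 2 * Dj)) <= p * (th i * (Delta * F)).
    by rewrite ler_wpM2l// ltW.
  have E5 : (al + 1) * (th i * Di + th j * Dj) * F <= Delta * F * F.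
    by rewrite ler_wpM2r// ltW.
  have al1 : 0 <= al + 1 by rewrite addr_ge0 ?ltW.
  have E6 : (al + 1) * (p * th i ^+ 2 * (F - Di) + p * th j ^+ 2 * (F - Dj)) <=
            (al + 1) * (th i * Di * F + th j * Dj * F).
    by rewrite ler_wpM2l// lerD.
  rewrite /B; move: E4 E5 E6; lra.
pose c := al * (L - 2 * th k) - th k.
suff pc : p * c <= F.
  rewrite -subr_ge0 (_ : _ - _ = th k * (F - p * c)); last by rewrite /c; ring.
  by rewrite mulr_ge0 ?subr_ge0// ltW.
have [c0|c0] := leP c 0; first by rewrite (@le_trans _ _ 0) ?mulr_ge0_le0 ?(ltW F0) ?(ltW p0).
have sq : 0 < th i ^+ 2 + th j ^+ 2 by rewrite addr_gt0 ?exprn_gt0.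
have alp : 0 < al + 1 by rewrite addr_gt0.
have Delta0 : 0 < Delta.
  rewrite ltNge; apply/negP => De0.
  have B0 : 0 < B.
    by rewrite /B ltr_wpDr ?mulr_gt0// oppr_ge0 mulr_ge0_le0// ltW.
  have : 0 < Delta * F by apply: lt_le_trans H1; rewrite mulr_gt0.
  by rewrite pmulr_lgt0// ltNge De0.
have cB : c * Delta <= B.
  rewrite /B lerBrDr -mulrDl.
  have ct : 0 < c + th i by rewrite addr_gt0.
  apply: le_trans (ler_wpM2l (ltW ct) DeltaL) _.
  have E1 : (L - 2 * th k) * (L + th k) <= 2 * (th i ^+ 2 + th j ^+ 2).
    rewrite -subr_ge0 (_ : _ - _ = (th i - th j) ^+ 2 +
      ((th i + th j) * th k + 2 * th k ^+ 2)); last by rewrite /L; ring.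
    by rewrite !addr_ge0 ?sqr_ge0// ?mulr_ge0 ?addr_ge0 ?sqr_ge0// ltW.
  have E2 : (th i - th k) * (L + th k) <= 2 * (th i ^+ 2 + th j ^+ 2).
    rewrite -subr_ge0 (_ : _ - _ = (th i - th j / 2) ^+ 2 + th j ^+ 2 * (7 / 4) +
      (th k * th j + th k ^+ 2)); last by rewrite /L; field.
    apply: addr_ge0; last by rewrite addr_ge0 ?sqr_ge0// mulr_ge0// ltW.
    by rewrite addr_ge0 ?sqr_ge0// mulr_ge0 ?sqr_ge0// divr_ge0.
  have E3 := ler_wpM2l (ltW al0) E1.
  by move: E2 E3; rewrite /c; lra.
rewrite -(ler_pM2r Delta0) -mulrA (le_trans (ler_wpM2l (ltW p0) cB))//.
by rewrite [F * _]mulrC.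
Qed.

(** The identities [E1] and [E2] are [gf_slopeE] and [gf_meanE] at the critical point: the
    totals of the defects weighted by the shapes, without and with the scales.
    Chebyshev's inequality ([E4]) handles the indices [i] and [j], whose defects are
    ordered as their scales, and [defect_small] all other indices ([E3]); combined they
    contradict [x1_gt]. *)
Lemma mode_gt_absurd : False.
Proof.
set L := th i + th j.
pose S F : R := \sum_(k < n | (k != i) && (k != j)) F k.
have sE : s = L + S th by rewrite /s bigD2.
have E1 : (al + 1) * (d i + d j) + al * S d = f x1.
  have := gf_slopeE a f g x1; rewrite Gx1 addr0 => <-.
  have dE : \sum_(k < n) (f x1 - g k x1) = d i + d j + S d by exact: bigD2.
  by rewrite big_shape dE -/(d i) -/(d j); ring.
have E2 : (al + 1) * (th i * d i + th j * d j) + al * S (fun k => th k * d k) =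
    (al * s + L - x1) * f x1.
  have := gf_meanE fam x1; under eq_bigr do rewrite -mulrA.
  rewrite !big_shape -/s => H; rewrite /L addrA -H.
  have dE : \sum_(k < n) th k * (f x1 - g k x1) =
      th i * d i + th j * d j + S (fun k => th k * d k) by exact: bigD2.
  by rewrite dE -/(d i) -/(d j); ring.
have E3 : al * (L * S d - 2 * S (fun k => th k * d k)) <= S th * f x1.
  rewrite /S !mulr_sumr -sumrB mulr_sumr mulr_suml; apply: ler_sum => k /andP[ki kj].
  by apply: le_trans (defect_small ki kj); rewrite -/L le_eqVlt; apply/orP; left; apply/eqP; ring.
have E4 : L * (d i + d j) <= 2 * (th i * d i + th j * d j).
  rewrite -subr_ge0 (_ : _ - _ = (th i - th j) * (d i - d j)); last by rewrite /L; ring.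
  by rewrite mulr_ge0 ?subr_ge0 ?defect_le.
have E5 : (al + 1) * (L * (d i + d j)) <= (al + 1) * (2 * (th i * d i + th j * d j)).
  by rewrite ler_wpM2l// addr_ge0// ltW.
have fx := f0 x10.
have E6 : (L - S th) * f x1 <= (2 * (al * s + L - x1)) * f x1.
  by rewrite -[X in _ <= X]mulrA -E2 mulrBl -{1}E1; move: E3 E5; lra.
move: E6; rewrite ler_pM2r//.
by move: x1_gt; rewrite sE; lra.
Qed.

End mode.
End mode_bound.

Section mode_bound_sym.
Context {R : realType} (n : nat) (al : R) (i j : 'I_n) (th : 'I_n -> R) (f : R -> R) (g : 'I_n -> R -> R).
Hypotheses (al0 : 0 < al) (ij : i != j).
Local Notation a := (pair_shape al i j).
Hypothesis fam : gamma_family a th f g.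
Hypothesis fam2 : forall k, exists h,
  gamma_family (fun m => a m + (m == k)%:R) th (g k) h.

Lemma pair_shapeC : pair_shape al i j = pair_shape al j i.
Proof. by apply/funext => k; rewrite /pair_shape addrAC. Qed.

Lemma gf_mode_le (x1 : R) : 0 < x1 -> gf_slope a f g x1 = 0 ->
  (forall x : R, 0 < x -> x < x1 -> 0 < gf_slope a f g x) ->
  x1 <= (al + 2^-1) * \sum_(k < n) th k.
Proof.
move=> x10 Gx1 Gpos; rewrite leNgt; apply/negP => x1gt.
have [thij|/ltW thij] := leP (th j) (th i).
  exact: (mode_gt_absurd al0 ij fam fam2 x10 Gx1 Gpos).
have ji : j != i by rewrite eq_sym.
move: fam fam2 Gx1 Gpos; rewrite pair_shapeC => fam' fam2' Gx1' Gpos'.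
exact: (mode_gt_absurd al0 ji fam' fam2' x10 Gx1' Gpos').
Qed.

Lemma gf_nonincr_above x y : (al + 2^-1) * \sum_(k < n) th k <= x -> x <= y -> f y <= f x.
Proof.
have A1 := sum_shape_gt1 i j al0.
have [x1 [x10 Gx1 Gpos]] := gf_first_zero fam A1.
have x1le := gf_mode_le x10 Gx1 Gpos.
move=> /(le_trans x1le) x1x; rewrite le_eqVlt => /predU1P[->//|xy].
have x0 : 0 < x by exact: lt_le_trans x1x.
have fd (t : R) : t \in `]x, y[ -> is_derive t 1 f (gf_slope a f g t / t).
  by rewrite in_itv/= => /andP[xt _]; apply: (gf_derive fam); exact: lt_trans xt.
have fc : {within `[x, y], continuous f} by exact/continuous_subspaceT/(gf_cont fam).
have [t] := MVT xy fd fc; rewrite in_itv/= => /andP[xt ty] E.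
rewrite -subr_le0 E mulr_le0_ge0 ?subr_ge0 ?(ltW xy)// mulr_le0_ge0 ?invr_ge0//.
  by apply: (gf_unimodal fam A1 x10 Gx1 Gpos); rewrite (le_trans x1x) ?ltW.
by rewrite ltW// (lt_trans x0).
Qed.

Lemma gf_ndecr_pair x y : 0 <= x -> x <= y ->
  y <= (al - 1) * \sum_(k < n) th k + th i + th j -> f x <= f y.
Proof.
move=> x0 xy yB; apply: (gf_ndecr_below fam x0 xy).
apply: (le_trans yB); under [leRHS]eq_bigr do rewrite mulrBl mul1r.
by rewrite sumrB big_shape//; rewrite le_eqVlt; apply/orP; left; apply/eqP; ring.
Qed.

End mode_bound_sym.

(** * The gamma law *)

Section gamma_law.
Context {R : realType} (a b : R).
Hypothesis b0 : 0 < b.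
Local Notation GR := (measurableTypeR R).
Variable nu : probability GR R.
Hypothesis nuE : forall V : set R, measurable V -> nu V = gamma_prob a b V.
Local Notation leb := (@lebesgue_measure R).
Local Notation p := (gamma_pdf a b).

(** As inverses of zero vanish, a vanishing normalization would make the density, hence
    the total mass of [nu], equal to zero. *)
Lemma gamma_fun_gt0 : 0 < gamma_fun a.
Proof.
rewrite lt_neqAle; apply/andP; split; last first.
  by apply: Rintegral_ge0 => t _; rewrite mulr_ge0 ?powR_ge0 ?expR_ge0.
apply/negP => /eqP Ga.
have := nuE measurableT; rewrite probability_setT /gamma_prob integral0_eq.
  by move=> /eqP; rewrite onee_eq0.
by move=> x _; rewrite /gamma_pdf -Ga invr0 mulr0 !mul0r; case: ifP.
Qed.

Lemma gamma_pdf_ge0 x : 0 <= p x.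
Proof.
rewrite /gamma_pdf; case: ifP => // x0.
by rewrite !mulr_ge0 ?powR_ge0 ?expR_ge0// invr_ge0 ltW// gamma_fun_gt0.
Qed.

Lemma gamma_pdf_gt0 x : 0 < x -> 0 < p x.
Proof.
move=> x0; rewrite /gamma_pdf x0.
by rewrite !mulr_gt0 ?powR_gt0 ?expR_gt0// invr_gt0 gamma_fun_gt0.
Qed.

Lemma measurable_gamma_pdf : measurable_fun setT p.
Proof.
apply: measurable_fun_ifT => //=.
  by apply: measurable_fun_ltr => //; exact: measurable_cst.
apply: measurable_funM; first apply: measurable_funM.
- exact: measurable_cst.
- exact: measurable_powR.
- by apply: measurableT_comp => //; apply: measurable_funM.
Qed.

Lemma gamma_law_le0 : nu [set x | x <= 0] = 0%E.
Proof.
rewrite nuE; last by rewrite -set_itvNyc.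
rewrite /gamma_prob integral0_eq// => x /= x0.
by rewrite /gamma_pdf ltNge x0.
Qed.

Lemma gamma_law_dom : nu `<< leb.
Proof.
apply/null_content_dominatesP => A mA A0; rewrite nuE// /gamma_prob.
apply: null_set_integral; [exact: mA| |exact: A0].
apply/measurable_EFinP; apply: measurable_funTS; exact: measurable_gamma_pdf.
Qed.

(** The law has the gamma density as a Radon-Nikodym derivative, almost everywhere. *)
Lemma integral_gamma_law (h : GR -> R) (M : R) : measurable_fun setT h ->
  (forall x, 0 <= h x <= M) ->
  (\int[nu]_x (h x)%:E = \int[leb]_x (h x * p x)%:E)%E.
Proof.
move=> mh hM.
have ih : nu.-integrable setT (EFin \o h).
  apply: measurable_bounded_integrable => //.
    by rewrite (le_lt_trans (probability_le1 nu measurableT)) ?ltry.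
  exists M; split; first exact: num_real.
  move=> y My x _ /=; have /andP[h0 hxM] := hM x.
  by rewrite ger0_norm// (le_trans hxM)// ltW.
rewrite -(Radon_Nikodym_change_of_variables gamma_law_dom measurableT ih).
apply: ae_eq_integral => //.
- apply: emeasurable_funM; first exact/measurable_EFinP.
  apply: (measurable_int leb).
  by apply: Radon_Nikodym_integrable; exact: gamma_law_dom.
- by apply/measurable_EFinP/measurable_funM => //; exact: measurable_gamma_pdf.
apply: (@ae_eqe_mul2l _ _ _ leb setT _ (EFin \o p) (EFin \o h)).
rewrite Radon_NikodymE//=; first exact: gamma_law_dom.
move=> abmu; case: cid => /= g [g1 g2 g3].
apply: integral_ae_eq => //=.
  apply/measurable_EFinP; exact: measurable_gamma_pdf.
by move=> E E01 mE; rewrite -g3//= nuE.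
Qed.

End gamma_law.

Section gamma_stein.
Context {R : realType} (a b : R).
Hypotheses (a0 : 0 < a) (b0 : 0 < b).
Local Notation GR := (measurableTypeR R).
Variable nu : probability GR R.
Hypothesis nuE : forall V : set R, measurable V -> nu V = gamma_prob a b V.
Local Notation leb := (@lebesgue_measure R).
Local Notation p := (gamma_pdf a b).
Let pdf_ge0 := gamma_pdf_ge0 nuE.

Lemma gamma_pdf_derive (t : R) : 0 < t -> is_derive t 1 p (((a - 1) / t - b) * p t).
Proof.
move=> t0.
pose k := b `^ a / gamma_fun a.
have H0 := is_derive1_powR (a - 1) t0.
have H1 : is_derive t 1 (fun s => k * s `^ (a - 1) * expR (- b * s))
   (((a - 1) / t - b) * (k * t `^ (a - 1) * expR (- b * t))).
  apply: is_derive_eq; rewrite /GRing.scale/=.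
  have -> : t `^ (a - 1 - 1) = t `^ (a - 1) / t.
    by rewrite [LHS]powRB ?powRr1 ?(gt_eqF t0) ?implybT// ltW.
  by field; rewrite gt_eqF.
have -> : p t = k * t `^ (a - 1) * expR (- b * t) by rewrite /gamma_pdf t0.
apply: (@near_eq_is_derive R R^o R^o _ p) H1.
near=> s; rewrite /gamma_pdf ifT//; near: s; exact: lt_nbhsr.
Unshelve. all: by end_near. Qed.

Lemma gamma_pdf_cont (t : R) : 0 < t -> {for t, continuous p}.
Proof.
move=> t0; have [H _] := gamma_pdf_derive t0.
by apply: differentiable_continuous; apply/derivable1_diffP.
Qed.

Variables (m : nat) (lam c : R).
Hypotheses (lam0 : 0 < lam) (c0 : 0 < c).
Let C := c / lam.
Let q1 (t : R) := (a + m%:R) * t ^+ m * (c - lam * t).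
Let q2 (t : R) := b * t ^+ m.+1 * (c - lam * t) + lam * t ^+ m.+1.
Let Q (t : R) := t ^+ m.+1 * (c - lam * t) * p t.

Let C0 : 0 < C. Proof. exact: divr_gt0. Qed.

Let Q_derive (t : R) : 0 < t -> is_derive t 1 Q (q1 t * p t - q2 t * p t).
Proof.
move=> t0; have H := gamma_pdf_derive t0.
have H1 : is_derive t 1 (fun s : R => s ^+ m.+1) (m.+1%:R * t ^+ m).
  have := @is_deriveX _ _ id m.+1 t 1 1 (is_derive_id _ _).
  rewrite /GRing.scale/= mulr1; apply: (@near_eq_is_derive R R^o R^o).
  by near=> s; rewrite exprfctE.
have H2 : is_derive t 1 (fun s => c - lam * s) (- lam).
  by have := is_deriveB (is_derive_cst c t 1) (is_deriveM (is_derive_cst lam t 1) (is_derive_id t 1)); rewrite /GRing.scale/= mulr0 mulr1 addr0 add0r.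
have := is_deriveM (is_deriveM H1 H2) H.
rewrite /GRing.scale/= => H3; apply: (is_derive_eq H3).
rewrite mulrfctE /q1 /q2 /= exprS -natr1; field; exact: lt0r_neq0.
Unshelve. all: by end_near. Qed.

Let q_cont : continuous q1 /\ continuous q2.
Proof.
have cX k : continuous (fun t : R => t ^+ k) by exact: exprn_continuous.
have cL : continuous (fun t : R => c - lam * t).
  by move=> t; apply: cvgB; [exact: cvg_cst|apply: cvgMr; exact: cvg_id].
split=> t.
  by apply: cvgM; [apply: cvgMr; exact: cX|exact: cL].
apply: cvgD; last by apply: cvgMr; exact: cX.
by apply: cvgM; [apply: cvgMr; exact: cX|exact: cL].
Qed.

(** Integration by parts: [q1 * p - q2 * p] is the derivative of [Q], which vanishes at
    the right end [C].  The left end is kept away from [0] because the density may be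
    unbounded there. *)
Lemma gamma_stein_segment e : 0 < e -> e < C ->
  (\int[leb]_(t in `[e, C]) (q2 t * p t)%:E =
   \int[leb]_(t in `[e, C]) (q1 t * p t)%:E + (Q e)%:E)%E.
Proof.
move=> e0 eC.
have pc (q : R -> R) : continuous q -> {within `[e, C], continuous (fun t => q t * p t)}.
  move=> cq; apply: continuous_in_subspaceT => t; rewrite inE/= in_itv/= => /andP[et _].
  by apply: cvgM; [exact: cq|apply: gamma_pdf_cont; exact: lt_le_trans et].
have [c1 c2] := q_cont.
have i1 : leb.-integrable `[e, C] (EFin \o (fun t => q1 t * p t)).
  by apply: continuous_compact_integrable; [exact: segment_compact|exact: pc].
have i2 : leb.-integrable `[e, C] (EFin \o (fun t => q2 t * p t)).
  by apply: continuous_compact_integrable; [exact: segment_compact|exact: pc].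
have Qc t : 0 < t -> {for t, continuous Q}.
  move=> t0; have [H _] := Q_derive t0.
  by apply: differentiable_continuous; apply/derivable1_diffP.
have : (\int[leb]_(t in `[e, C]) (q1 t * p t - q2 t * p t)%:E = (Q C)%:E - (Q e)%:E)%E.
  apply: continuous_FTC2 => //.
  - move=> t; apply: cvgB; [exact: pc|exact: pc].
  - split.
    + move=> t; rewrite in_itv/= => /andP[et _].
      by have [] := Q_derive (lt_trans e0 et).
    + by apply: cvg_at_right_filter; exact: Qc.
    + by apply: cvg_at_left_filter; apply: Qc; exact: lt_trans eC.
  - move=> t; rewrite in_itv/= => /andP[et _].
    by rewrite derive1E; have [_ ->] := Q_derive (lt_trans e0 et).
under eq_integral do rewrite EFinB.
rewrite integralB_EFin//.
have -> : Q C = 0 by rewrite /Q /C mulrCA divff ?gt_eqF// mulr1 subrr mulr0 mul0r.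
have f1 : (\int[leb]_(t in `[e, C]) (q1 t * p t)%:E)%E \is a fin_num.
  exact: integrable_fin_num i1.
have f2 : (\int[leb]_(t in `[e, C]) (q2 t * p t)%:E)%E \is a fin_num.
  exact: integrable_fin_num i2.
rewrite sub0e -(fineK f1) -(fineK f2) -EFinB -EFinD => -[E]; congr EFin.
by move: E; set I1 := fine _; set I2 := fine _; lra.
Qed.

Let q_ge0 (t : R) : 0 < t -> t <= C -> 0 <= q1 t /\ 0 <= q2 t.
Proof.
move=> t0; rewrite /C ler_pdivlMr// mulrC -subr_ge0 => ct.
have am : 0 <= a + m%:R by rewrite addr_ge0 ?ler0n ?ltW.
have tm k : 0 <= t ^+ k by rewrite exprn_ge0 ?ltW.
split; first by rewrite mulr_ge0// mulr_ge0.
by apply: addr_ge0; rewrite mulr_ge0 ?(ltW lam0)// mulr_ge0 ?(ltW b0).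
Qed.

Let Q_cvg0 (e : R^nat) : (forall k, 0 < e k) -> e @ \oo --> 0 -> (Q \o e) @ \oo --> (0 : R).
Proof.
move=> e0 ecvg.
pose k := b `^ a / gamma_fun a.
have QE t : 0 < t -> Q t = k * t `^ a * (t ^+ m * (c - lam * t) * expR (- b * t)).
  move=> t0; rewrite /Q /gamma_pdf t0 -/k -(mulr_powRB1 (ltW t0) a0) exprS; ring.
suff : Q t @[t --> 0^'+] --> (0 : R) by move/cvg_at_rightP; apply; split.
apply: (@cvg_trans _ ((fun t => k * t `^ a * (t ^+ m * (c - lam * t) * expR (- b * t))) t @[t --> 0^'+])).
  apply: near_eq_cvg; near=> t; rewrite QE//; near: t; exact: nbhs_right_gt.
suff : (fun t => k * t `^ a * (t ^+ m * (c - lam * t) * expR (- b * t))) t @[t --> 0^'+] -->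
    k * 0 * (0 ^+ m * (c - lam * 0) * expR (- b * 0)) by rewrite mulr0 mul0r.
apply: cvgM; first by apply: cvgMr; exact: powR_cvg0.
apply: cvg_at_right_filter; apply: cvgM; first apply: cvgM.
- exact: exprn_continuous.
- by apply: cvgB; [exact: cvg_cst|apply: cvgMr; exact: cvg_id].
- apply: (@continuous_comp _ _ _ (fun t => - b * t) expR); last exact: continuous_expR.
  by apply: cvgMr; exact: cvg_id.
Unshelve. all: by end_near. Qed.

(** As [e] tends to [0] the boundary term [Q e] vanishes, being bounded by a
    multiple of [e `^ a] with [a > 0]; both integrands are nonnegative, so the integrals converge
    monotonically. *)
Lemma gamma_stein_itv :
  (\int[leb]_(t in `]0%R, C]) (q2 t * p t)%:E = \int[leb]_(t in `]0%R, C]) (q1 t * p t)%:E)%E.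
Proof.
pose e (k : nat) : R := C / k.+2%:R.
have e0 k : 0 < e k by rewrite divr_gt0.
have eC k : e k < C by rewrite ltr_pdivrMr// ltr_pMr// ltr1n.
have ecvg : e @ \oo --> (0 : R).
  rewrite -[X in _ --> X](mulr0 C); apply: cvgMr.
  have := @cvg_harmonic R; rewrite -(cvg_shiftn 1)/=.
  by under eq_fun do rewrite addn1.
have UE : \bigcup_k `[e k, C]%classic = `]0, C]%classic.
  apply/seteqP; split => [t [k _] /=|t /=]; rewrite !in_itv/=.
    by move=> /andP[et ->]; rewrite (lt_le_trans (e0 k)).
  move=> /andP[t0 tC].
  have /cvgr_lt/(_ _ t0)[k _ /(_ k (leqnn k)) ek] := ecvg.
  by exists k => //=; rewrite in_itv/= tC andbT ltW.
have mp : measurable_fun [set: GR] p by exact: measurable_gamma_pdf.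
have key (q : R -> R) : continuous q -> (forall t, 0 < t -> t <= C -> 0 <= q t) ->
    (\int[leb]_(t in `[e k, C]) (q t * p t)%:E)%E @[k --> \oo] -->
      (\int[leb]_(t in `]0%R, C]) (q t * p t)%:E)%E.
  move=> cq q0; rewrite -UE.
  have mq : measurable_fun [set: GR] (fun t => (q t * p t)%:E).
    apply/measurable_EFinP; apply: measurable_funM => //.
    exact: continuous_measurable_fun.
  apply: ge0_nondecreasing_set_cvg_integral.
  - apply/nondecreasing_seqP => k; apply/subsetPset => t /=; rewrite !in_itv/=.
    move=> /andP[et ->]; rewrite andbT (le_trans _ et)// /e ler_pM2l// lef_pV2 ?posrE//.
    by rewrite ler_nat.
  - by move=> k; exact: measurable_itv.
  - by move=> k; exact: measurable_funTS.
  - move=> k t; rewrite /= in_itv/= => /andP[et tC].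
    by rewrite lee_fin mulr_ge0// q0// (lt_le_trans (e0 k)).
have [c1 c2] := q_cont.
have K1 := key q1 c1 (fun t t0 tC => (q_ge0 t0 tC).1).
have K2 := key q2 c2 (fun t t0 tC => (q_ge0 t0 tC).2).
have K3 : (\int[leb]_(t in `[e k, C]) (q1 t * p t)%:E + (Q (e k))%:E)%E @[k --> \oo] -->
      (\int[leb]_(t in `]0%R, C]) (q1 t * p t)%:E + 0%:E)%E.
  apply: cvgeD => //; first by rewrite fin_num_adde_defl.
  by apply/fine_cvgP; split; [exact: nearW|exact: Q_cvg0].
rewrite -[RHS]adde0.
apply: (cvg_unique _ K2) => //; apply: cvg_trans K3.
by apply: near_eq_cvg; near=> k; rewrite gamma_stein_segment.
Unshelve. all: by end_near. Qed.

End gamma_stein.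

(** Positive parts replace the variables themselves throughout: a gamma variable is only
    almost surely positive, and positivity everywhere removes the exceptional sets. *)
Definition pos {R : realType} (t : R) : R := Num.max t 0.

Lemma pos_ge0 {R : realType} (t : R) : 0 <= pos t.
Proof. by rewrite /pos le_max lexx orbT. Qed.

Lemma pos_id {R : realType} (t : R) : 0 <= t -> pos t = t.
Proof. by move=> t0; rewrite /pos max_l. Qed.

Lemma pos0 {R : realType} (t : R) : t <= 0 -> pos t = 0.
Proof. by move=> t0; rewrite /pos max_r. Qed.

Lemma measurable_pos {R : realType} d (T : measurableType d) (f : T -> R) :
  measurable_fun setT f -> measurable_fun setT (fun x => pos (f x)).
Proof. by move=> mf; apply: measurable_maxr => //; exact: measurable_cst. Qed.

Lemma measurable_lt_ind {R : realType} d (T : measurableType d) (f g : T -> R) :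
  measurable_fun setT f -> measurable_fun setT g ->
  measurable_fun setT (fun x => (f x < g x)%R%:R : R).
Proof.
move=> mf mg.
rewrite (_ : (fun x => _) = (fun x => if f x < g x then 1 else 0)); last first.
  by apply/funext => x; case: ifP.
by apply: measurable_fun_ifT => //; exact: measurable_fun_ltr.
Qed.

Section gamma_stein.
Context {R : realType} (a b : R).
Hypotheses (a0 : 0 < a) (b0 : 0 < b).
Local Notation GR := (measurableTypeR R).
Variable nu : probability GR R.
Hypothesis nuE : forall V : set R, measurable V -> nu V = gamma_prob a b V.
Local Notation leb := (@lebesgue_measure R).
Local Notation p := (gamma_pdf a b).

(** Integration by parts against the gamma density for the test function
    [t ^+ m.+1 * (c - lam * t)_+].  It is the identity through which the independent
    variables enter the proof. *)
Lemma gamma_stein m (lam c : R) : 0 < lam ->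
  (\int[nu]_t ((a + m%:R) * pos t ^+ m * pos (c - lam * pos t))%:E =
   \int[nu]_t (b * pos t ^+ m.+1 * pos (c - lam * pos t) +
               lam * pos t ^+ m.+1 * (lam * pos t < c)%R%:R)%:E)%E.
Proof.
move=> lam0; have [c0|c0] := leP c 0.
  rewrite !integral0_eq// => t _.
    rewrite ltNge (le_trans c0) ?mulr_ge0 ?pos_ge0 ?(ltW lam0)// mulr0 addr0.
    by rewrite [pos (c - _)]pos0 ?mulr0// subr_le0 (le_trans c0)// mulr_ge0 ?pos_ge0// ltW.
  by rewrite [pos (c - _)]pos0 ?mulr0// subr_le0 (le_trans c0)// mulr_ge0 ?pos_ge0// ltW.
set h1 := fun t : R => (a + m%:R) * pos t ^+ m * pos (c - lam * pos t).
set h2 := fun t : R => b * pos t ^+ m.+1 * pos (c - lam * pos t) +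
               lam * pos t ^+ m.+1 * (lam * pos t < c)%R%:R.
pose C := c / lam.
have C0 : 0 < C by exact: divr_gt0.
have am : 0 <= a + m%:R by rewrite addr_ge0 ?ler0n ?ltW.
have mid : measurable_fun [set: R] (id : R -> R) by exact: measurable_id.
have mpos := measurable_pos mid.
have mcl : measurable_fun [set: R] (fun t : R => pos (c - lam * pos t)).
  by apply/measurable_pos/measurable_funB; [exact: measurable_cst|exact: measurable_funM].
have mh1 : measurable_fun [set: R] h1.
  apply: measurable_funM => //; apply: measurable_funM; first exact: measurable_cst.
  exact: measurable_funX.
have mh2 : measurable_fun [set: R] h2.
  apply: measurable_funD; apply: measurable_funM => //.
  - by apply: measurable_funM; [exact: measurable_cst|exact: measurable_funX].
  - by apply: measurable_funM; [exact: measurable_cst|exact: measurable_funX].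
  - by apply: measurable_lt_ind; [exact: measurable_funM|exact: measurable_cst].
have posC k t : lam * pos t < c -> pos t ^+ k <= C ^+ k.
  move=> tc; apply: lerXn2r; rewrite ?nnegrE ?pos_ge0 ?(ltW C0)//.
  by rewrite /C ler_pdivlMr// mulrC ltW.
have pc t : pos (c - lam * pos t) <= c.
  by rewrite /pos ge_max (ltW c0) andbT gerBl mulr_ge0 ?pos_ge0 ?(ltW lam0).
have h1M t : 0 <= h1 t <= (a + m%:R) * C ^+ m * c.
  rewrite /h1 !mulr_ge0 ?exprn_ge0 ?pos_ge0//=.
  have [tc|tc] := ltP (lam * pos t) c.
    by rewrite ler_pM ?mulr_ge0 ?exprn_ge0 ?pos_ge0// ler_wpM2l// posC.
  rewrite [pos (c - _)]pos0 ?subr_le0// mulr0.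
  by rewrite mulr_ge0 ?(ltW c0)// mulr_ge0// exprn_ge0// ltW.
have h2M t : 0 <= h2 t <= b * C ^+ m.+1 * c + lam * C ^+ m.+1.
  rewrite /h2 addr_ge0 ?mulr_ge0 ?exprn_ge0 ?pos_ge0 ?(ltW b0) ?(ltW lam0)//=.
  have [tc|tc] := ltP (lam * pos t) c.
    rewrite mulr1 lerD// ?ler_wpM2l ?posC ?(ltW lam0)//.
    by rewrite ler_pM ?mulr_ge0 ?exprn_ge0 ?pos_ge0 ?(ltW b0)// ler_wpM2l ?(ltW b0)// posC.
  rewrite [pos (c - _)]pos0 ?subr_le0// !mulr0 addr0.
  by rewrite addr_ge0// !mulr_ge0 ?exprn_ge0 ?(ltW b0) ?(ltW lam0) ?(ltW c0) ?(ltW C0).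
rewrite (integral_gamma_law nuE mh1 h1M) (integral_gamma_law nuE mh2 h2M).
have mp : measurable_fun [set: R] p by exact: measurable_gamma_pdf.
have red (h q : R -> R) : measurable_fun [set: R] h -> measurable_fun [set: R] q ->
   (forall t, 0 < t -> t < C -> h t = q t) -> (forall t, C <= t -> h t = 0) ->
   (\int[leb]_t (h t * p t)%:E = \int[leb]_(t in `]0%R, C]) (q t * p t)%:E)%E.
  move=> mh mq hq hC.
  rewrite -integral_itv_bndo_bndc; last first.
    apply/measurable_EFinP; apply: measurable_funTS; exact: measurable_funM.
  rewrite [RHS]integral_mkcond; apply: eq_integral => t _.
  rewrite patchE mem_setE in_itv/=; case: ifPn => [/andP[t0 tC]|]; first by rewrite hq.
  rewrite negb_and -!leNgt => /orP[t0|tC]; last by rewrite hC// mul0r.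
  by rewrite /gamma_pdf ltNge t0 mulr0.
have pt t : 0 < t -> t < C -> pos (c - lam * t) = c - lam * t.
  by move=> _ tC; rewrite pos_id// subr_ge0 mulrC -ler_pdivlMr// ltW.
have Ct t : C <= t -> pos (c - lam * pos t) = 0.
  move=> tC; rewrite pos0// (pos_id (le_trans (ltW C0) tC)).
  by rewrite subr_le0 mulrC -ler_pdivrMr.
have mcX k : measurable_fun [set: R] (fun t : R => t ^+ k) by exact: exprn_measurable.
have mcl' : measurable_fun [set: R] (fun t : R => c - lam * t).
  by apply: measurable_funB; [exact: measurable_cst|exact: measurable_funM].
rewrite (red _ (fun t => (a + m%:R) * t ^+ m * (c - lam * t)))//; first last.
- by move=> t tC; rewrite /h1 Ct// mulr0.
- by move=> t t0 tC; rewrite /h1 (pos_id (ltW t0)) pt.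
- by apply: measurable_funM => //; apply: measurable_funM => //; exact: measurable_cst.
rewrite (red h2 (fun t => b * t ^+ m.+1 * (c - lam * t) + lam * t ^+ m.+1))//; first last.
- move=> t tC; rewrite /h2 Ct// mulr0 (pos_id (le_trans (ltW C0) tC)).
  have -> : (lam * t < c) = false by rewrite ltNge mulrC -ler_pdivrMr// -/C tC.
  by rewrite mulr0 addr0.
- move=> t t0 tC; rewrite /h2 (pos_id (ltW t0)) pt//.
  have -> : lam * t < c by rewrite mulrC -ltr_pdivlMr.
  by rewrite mulr1.
- apply: measurable_funD; last by apply: measurable_funM => //; exact: measurable_cst.
  by apply: measurable_funM => //; apply: measurable_funM => //; exact: measurable_cst.
exact/esym/(gamma_stein_itv a0 b0 nuE m lam0 c0).
Qed.

End gamma_stein.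

(** * Splitting off one of the independent variables *)

Section independence.
Context {R : realType} d (T : measurableType d) (P : probability T R) (n : nat)
  (X : 'I_n -> {RV P >-> R}) (k : 'I_n).
Hypothesis indX : mutually_independent X.
Local Notation GR := (measurableTypeR R).

(** The events determined by the variables other than [X k]; they form a pi-system that
    generates the sigma-algebra on which the remaining variables live. *)
Definition other_cylinders : set (set T) := [set B | exists2 A : 'I_n -> set R,
  (forall i, measurable (A i)) & B = \bigcap_(i in [set` (~: [set k])%SET]) X i @^-1` A i].

Lemma measurable_RV_preimage i (A : set R) : measurable A -> measurable (X i @^-1` A).
Proof. by move=> mA; rewrite -[X in measurable X]setTI; exact: measurable_funP. Qed.

Lemma other_cylinders_measurable : other_cylinders `<=` measurable.
Proof.
move=> B [A mA ->]; apply: fin_bigcap_measurable => // i _.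
exact: measurable_RV_preimage.
Qed.

(** Both sides are finite measures in [B] that agree on the pi-system of cylinders by
    mutual independence. *)
Lemma indep_other_cylinders (A : set R) (B : set T) : measurable A -> <<s other_cylinders >> B ->
  P (X k @^-1` A `&` B) = (P (X k @^-1` A) * P B)%E.
Proof.
move=> mA sB.
have mXA := measurable_RV_preimage k mA.
have pA0 : 0 <= fine (P (X k @^-1` A)) by rewrite fine_ge0.
pose m1 := mrestr P mXA.
pose m2 := mscale (NngNum pA0) P.
have m2E C : m2 C = (P (X k @^-1` A) * P C)%E.
  by rewrite /m2 /mscale/= fineK// fin_num_measure.
have m1E C : m1 C = P (X k @^-1` A `&` C) by rewrite /m1 /mrestr/= setIC.
rewrite -m2E -m1E.
apply: (@g_sigma_algebra_measure_unique _ _ _ other_cylinders other_cylinders_measurable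
   (fun _ => setT)) => //.
- move=> _; exists (fun _ => setT) => //.
  by apply/seteqP; split.
- by rewrite bigcup_const.
- move=> C D [A1 mA1 ->] [A2 mA2 ->]; exists (fun i => A1 i `&` A2 i).
    by move=> i; exact: measurableI.
  apply/seteqP; split => [w [h1 h2] i Ji|w h]; first by split; [exact: h1|exact: h2].
  by split=> i Ji; have [] := h i Ji.
- move=> C [A1 mA1 ->]; rewrite [LHS]m1E [RHS]m2E.
  pose A' i := if i == k then A else A1 i.
  have mA' i : measurable (A' i) by rewrite /A'; case: ifP.
  have -> : X k @^-1` A `&` \bigcap_(i in [set` (~: [set k])%SET]) X i @^-1` A1 i =
      \bigcap_(i in [set` [set: 'I_n]%SET]) X i @^-1` A' i.
    apply/seteqP; split => [w [Aw A1w] i _|w Aw].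
      rewrite /= /A'; case: eqP => [->//|/eqP ik].
      by apply: A1w; rewrite /= !inE.
    split; first by have := Aw k; rewrite /= /A' eqxx; apply; rewrite inE.
    move=> i /=; rewrite !inE => /negPf ik.
    by have := Aw i; rewrite /= /A' ik; apply; rewrite inE.
  rewrite (indX [set: 'I_n]%SET mA') (indX (~: [set k])%SET mA1) (bigD1 k) ?inE//=.
  rewrite {1}/A' eqxx; congr (_ * _)%E.
  apply: eq_big => [i|i /andP[_ ik]]; first by rewrite !inE.
  by rewrite /A' (negPf ik).
- by move=> j; rewrite [ltLHS]m1E setIT (le_lt_trans (probability_le1 P _)) ?ltry.
Qed.

Local Notation T' := (g_sigma_algebraType other_cylinders).

Lemma others_sub (B : set T') : measurable B -> d.-measurable (B : set T).
Proof.
move=> mB; apply: (smallest_sub (@sigma_algebra_measurable _ T) other_cylinders_measurable).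
exact: mB.
Qed.

Definition to_others (w : T) : T' := w.

Definition RV_GR (w : T) : GR := X k w.

Definition split_RV (w : T) : GR * T' := (RV_GR w, to_others w).

Lemma measurable_to_others : measurable_fun [set: T] to_others.
Proof. by move=> _ B mB; rewrite setTI; exact: others_sub. Qed.

Lemma measurable_RV_GR : measurable_fun [set: T] RV_GR.
Proof. by move=> _ A mA; rewrite setTI; exact: measurable_RV_preimage. Qed.

Lemma measurable_split_RV : measurable_fun [set: T] split_RV.
Proof.
apply: measurable_fun_pair; [exact: measurable_RV_GR|exact: measurable_to_others].
Qed.

HB.instance Definition _ := isMeasurableFun.Build _ _ _ _ to_others measurable_to_others.
HB.instance Definition _ := isMeasurableFun.Build _ _ _ _ RV_GR measurable_RV_GR.
HB.instance Definition _ := isMeasurableFun.Build _ _ _ _ split_RV measurable_split_RV.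

Lemma measurable_other_RV i : i != k -> measurable_fun [set: T'] (X i : T' -> R).
Proof.
move=> ik _ A mA; rewrite setTI; apply: sub_sigma_algebra.
exists (fun j => if j == i then A else setT); first by move=> j; case: ifP.
apply/seteqP; split => [w Aw j _|w Aw]; first by rewrite /=; case: eqP => // ->.
by have := Aw i; rewrite /= eqxx; apply; rewrite /= !inE.
Qed.

Lemma law_split_RV (C : set (GR * T')) : measurable C ->
  distribution P split_RV C = (distribution P RV_GR \x distribution P to_others)%E C.
Proof.
move=> mC; apply/esym; apply: product_measure_unique => // A B mA mB.
exact: indep_other_cylinders.
Qed.

(** A form of conditioning on the other variables: the joint law of [X k] and of the
    identity, seen through the sigma-algebra of the others, is a product measure. *)
Lemma integral_split_RV (h : GR * T' -> \bar R) : measurable_fun setT h ->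
  (forall z, 0 <= h z)%E ->
  (\int[P]_w h (X k w, w) =
   \int[distribution P to_others]_v \int[distribution P RV_GR]_t h (t, v))%E.
Proof.
move=> mh h0.
have -> : (\int[P]_w h (X k w, w) = \int[distribution P split_RV]_z h z)%E.
  by rewrite ge0_integral_distribution.
rewrite (@eq_measure_integral _ _ _ _ (distribution P RV_GR \x distribution P to_others)%E).
  by rewrite fubini_tonelli2.
by move=> C mC _; exact: law_split_RV.
Qed.

End independence.

(** * Truncated moments of the weighted sum *)

Lemma bounded_integrable {R : realType} d (T : measurableType d) (P : probability T R)
  (f : T -> R) (M : R) : measurable_fun setT f -> (forall w, 0 <= f w <= M) ->
  P.-integrable setT (EFin \o f).
Proof.
move=> mf fM; apply: measurable_bounded_integrable => //.
  by rewrite (le_lt_trans (probability_le1 P measurableT)) ?ltry.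
exists M; split; first exact: num_real.
move=> y My w _ /=; have /andP[f0 fwM] := fM w.
by rewrite ger0_norm// (le_trans fwM)// ltW.
Qed.

Section integrable_real.
Context {R : realType} d (T : measurableType d) (P : probability T R).
Implicit Types f g : T -> R.
Local Notation integrable f := (P.-integrable setT (EFin \o f)).

Lemma integrableZR c f : integrable f -> integrable (fun w => c * f w).
Proof. by move=> /(integrableZl measurableT c); apply: eq_integrable. Qed.

Lemma integrableDR f g : integrable f -> integrable g -> integrable (fun w => f w + g w).
Proof. by move=> /(integrableD measurableT)/[apply]; apply: eq_integrable. Qed.

Lemma integrableBR f g : integrable f -> integrable g -> integrable (fun w => f w - g w).
Proof. by move=> /(integrableB measurableT)/[apply]; apply: eq_integrable. Qed.

Lemma integrable_sumR n (F : 'I_n -> T -> R) : (forall k, integrable (F k)) ->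
  integrable (fun w => \sum_(k < n) F k w).
Proof.
elim: n F => [|n IHn] F iF.
  under eq_fun do rewrite big_ord0.
  by apply: (@eq_integrable _ _ _ _ _ measurableT (cst 0%E)) => //; exact: integrable0.
under eq_fun do rewrite big_ord_recl.
by apply: integrableDR => //; apply: IHn.
Qed.

Lemma Rintegral_sum n (F : 'I_n -> T -> R) : (forall k, integrable (F k)) ->
  \int[P]_w (\sum_(k < n) F k w) = \sum_(k < n) \int[P]_w F k w.
Proof.
elim: n F => [|n IHn] F iF.
  under eq_Rintegral do rewrite big_ord0.
  by rewrite big_ord0 /Rintegral integral0.
under eq_Rintegral do rewrite big_ord_recl.
by rewrite big_ord_recl RintegralD ?IHn//; exact: integrable_sumR.
Qed.

End integrable_real.

Section moments.
Context {R : realType} d (T : measurableType d) (P : probability T R) (n : nat)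
  (X : 'I_n -> {RV P >-> R}).
Implicit Types (nu : 'I_n -> nat) (lam : 'I_n -> R) (k i : 'I_n).

Definition pRV i (w : T) : R := pos (X i w).
Definition mon nu w : R := \prod_(i < n) pRV i w ^+ nu i.
Definition wsum lam w : R := \sum_(i < n) lam i * pRV i w.
Definition ltmom lam nu (x : R) : R := \int[P]_w (mon nu w * (wsum lam w < x)%R%:R).
(** Antiderivative of [ltmom] in [x]; it is used because it is convex in [x] and in the
    weights without any regularity assumption. *)
Definition posmom lam nu (x : R) : R := \int[P]_w (mon nu w * pos (x - wsum lam w)).
Definition raise nu k : 'I_n -> nat := fun i => (nu i + (i == k))%N.

Lemma pRV_ge0 i w : 0 <= pRV i w. Proof. exact: pos_ge0. Qed.

Lemma mon_ge0 nu w : 0 <= mon nu w.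
Proof. by apply: prodr_ge0 => i _; rewrite exprn_ge0// pRV_ge0. Qed.

Lemma mon_raise nu k w : mon (raise nu k) w = pRV k w * mon nu w.
Proof.
rewrite /mon (bigD1 k)//= [in RHS](bigD1 k)//= /raise eqxx addn1 exprS -mulrA.
congr (_ * (_ * _)); apply: eq_bigr => i /negPf ->.
by rewrite addn0.
Qed.

Lemma measurable_pRV i : measurable_fun setT (pRV i).
Proof. exact/measurable_pos/measurable_funP. Qed.

Lemma measurable_mon nu : measurable_fun setT (mon nu).
Proof.
apply: measurable_prod => i _; apply: measurable_funX; exact: measurable_pRV.
Qed.

Lemma measurable_wsum lam : measurable_fun setT (wsum lam).
Proof.
apply: measurable_sum => i; apply: measurable_funM; first exact: measurable_cst.
exact: measurable_pRV.
Qed.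

Lemma measurable_ltmom lam nu x :
  measurable_fun setT (fun w => mon nu w * (wsum lam w < x)%R%:R).
Proof.
apply: measurable_funM; first exact: measurable_mon.
by apply: measurable_lt_ind; [exact: measurable_wsum|exact: measurable_cst].
Qed.

Lemma measurable_posmom lam nu x :
  measurable_fun setT (fun w => mon nu w * pos (x - wsum lam w)).
Proof.
apply: measurable_funM; first exact: measurable_mon.
by apply/measurable_pos/measurable_funB; [exact: measurable_cst|exact: measurable_wsum].
Qed.

Lemma wsum_ge0 lam w : (forall i, 0 <= lam i) -> 0 <= wsum lam w.
Proof. by move=> lam0; apply: sumr_ge0 => i _; rewrite mulr_ge0 ?pRV_ge0. Qed.

(** Positive weights make the truncation [wsum < x] bound every variable, so that all
    truncated moments are integrals of bounded functions. *)
Lemma mon_bound lam nu x w : (forall i, 0 < lam i) -> wsum lam w < x ->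
  mon nu w <= \prod_(i < n) (`|x| / lam i) ^+ nu i.
Proof.
move=> lam0 Yx; apply: ler_prod => i _; rewrite exprn_ge0 ?pRV_ge0//=.
apply: lerXn2r; rewrite ?nnegrE ?pRV_ge0 ?divr_ge0 ?(ltW (lam0 i))//.
rewrite ler_pdivlMr// mulrC (le_trans _ (ler_norm x))// (le_trans _ (ltW Yx))//.
rewrite /wsum (bigD1 i)//= lerDl sumr_ge0// => j _.
by rewrite mulr_ge0 ?pRV_ge0 ?ltW.
Qed.

Section positive_weights.
Variable lam : 'I_n -> R.
Hypothesis lam0 : forall i, 0 < lam i.

Lemma integrable_ltmom nu x :
  P.-integrable setT (EFin \o (fun w => mon nu w * (wsum lam w < x)%R%:R)).
Proof.
apply: (@bounded_integrable _ _ _ _ _ (\prod_(i < n) (`|x| / lam i) ^+ nu i)).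
  exact: measurable_ltmom.
move=> w; rewrite mulr_ge0 ?mon_ge0//=; have [Yx|Yx] := ltP.
  by rewrite mulr1; exact: mon_bound Yx.
by rewrite mulr0; apply: prodr_ge0 => i _; rewrite exprn_ge0// divr_ge0// ltW.
Qed.

Lemma integrable_posmom nu x :
  P.-integrable setT (EFin \o (fun w => mon nu w * pos (x - wsum lam w))).
Proof.
apply: (@bounded_integrable _ _ _ _ _ (\prod_(i < n) (`|x| / lam i) ^+ nu i * `|x|)).
  exact: measurable_posmom.
have Y0 w : 0 <= wsum lam w by apply: wsum_ge0 => i; exact: ltW.
have p0 : 0 <= \prod_(i < n) (`|x| / lam i) ^+ nu i.
  by apply: prodr_ge0 => i _; rewrite exprn_ge0// divr_ge0// ltW.
move=> w; rewrite mulr_ge0 ?mon_ge0 ?pos_ge0//=; have [Yx|Yx] := ltP (wsum lam w) x.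
  rewrite ler_pM ?mon_ge0 ?pos_ge0// ?(mon_bound _ lam0 Yx)//.
  by rewrite pos_id ?subr_ge0 ?(ltW Yx)// (le_trans _ (ler_norm x))// gerBl.
by rewrite pos0 ?subr_le0// mulr0 mulr_ge0.
Qed.

Lemma pos_subgrad (x y z : R) : (y - x) * (z < x)%R%:R <= pos (y - z) - pos (x - z).
Proof.
have [zx|zx] := ltP z x.
  rewrite mulr1 (@pos_id _ (x - z)) ?subr_ge0 ?(ltW zx)//.
  have : y - z <= pos (y - z) by rewrite /pos le_max lexx.
  lra.
by rewrite mulr0 (@pos0 _ (x - z)) ?subr_le0// subr0 pos_ge0.
Qed.

Lemma posmom_subgrad nu x y : (y - x) * ltmom lam nu x <= posmom lam nu y - posmom lam nu x.
Proof.
have i1 := integrable_ltmom nu x.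
have ix := integrable_posmom nu x; have iy := integrable_posmom nu y.
rewrite /ltmom /posmom -RintegralZl// -RintegralB//.
apply: le_Rintegral => //; [exact: integrableZR|exact: integrableBR|].
move=> w _; rewrite -mulrBr mulrCA ler_wpM2l ?mon_ge0//.
exact: pos_subgrad.
Qed.

(** [x - wsum] is expanded on the event where it is positive. *)
Lemma posmom_ltmom nu x :
  posmom lam nu x = x * ltmom lam nu x - \sum_(k < n) lam k * ltmom lam (raise nu k) x.
Proof.
have i0 := integrable_ltmom nu x.
have i1 k := integrable_ltmom (raise nu k) x.
rewrite /ltmom; under eq_bigr do rewrite -RintegralZl//.
rewrite -Rintegral_sum => [|k]; last exact: integrableZR.
rewrite -RintegralZl// -RintegralB//; last 2 first.
- exact: integrableZR.
- by apply: integrable_sumR => k; exact: integrableZR.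
apply: eq_Rintegral => w _.
under eq_bigr do rewrite mon_raise.
have -> : \sum_(i < n) lam i * (pRV i w * mon nu w * (wsum lam w < x)%R%:R) =
   wsum lam w * (mon nu w * (wsum lam w < x)%R%:R).
  by rewrite /wsum mulr_suml; apply: eq_bigr => i _; rewrite !mulrA.
rewrite -mulrBl mulrCA; congr (_ * _).
have [Yx|Yx] := ltP (wsum lam w) x; first by rewrite mulr1 pos_id// subr_ge0 ltW.
by rewrite mulr0 pos0// subr_le0.
Qed.

End positive_weights.
End moments.

Section stein.
Context {R : realType} d (T : measurableType d) (P : probability T R) (n : nat)
  (X : 'I_n -> {RV P >-> R}) (a b : R).
Hypotheses (a0 : 0 < a) (b0 : 0 < b) (iidX : iid_gamma X a b).
Variable lam : 'I_n -> R.
Hypothesis lam0 : forall i, 0 < lam i.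

(** The one-dimensional identity [gamma_stein] is applied to [X k] with the other
    variables frozen, their contribution to the sum being absorbed in [c = x - S w]. *)
Lemma posmom_stein nu k x :
  (a + (nu k)%:R) * posmom X lam nu x =
  b * posmom X lam (raise nu k) x + lam k * ltmom X lam (raise nu k) x.
Proof.
have [indX lawX] := iidX.
have iK v := integrable_posmom X lam0 v x.
have iU v := integrable_ltmom X lam0 v x.
rewrite /posmom /ltmom -!RintegralZl// -RintegralD//; [|exact: integrableZR|exact: integrableZR].
pose T' := g_sigma_algebraType (other_cylinders X k).
pose m := nu k.
pose W (w : T') : R := \prod_(i < n | i != k) pRV X i w ^+ nu i.
pose S (w : T') : R := \sum_(i < n | i != k) lam i * pRV X i w.
have mN i : i != k -> measurable_fun [set: T'] (pRV X i : T' -> R).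
  move=> ik; apply: (@measurable_pos _ _ T' (X i : T' -> R)).
  exact: measurable_other_RV.
have mW : measurable_fun setT W.
  rewrite /W; under eq_fun do rewrite -big_filter.
  apply: measurable_prod => i; rewrite mem_filter => /andP[ik _].
  by apply: measurable_funX; exact: mN.
have mS : measurable_fun setT S.
  have -> : S = fun w => \sum_(i < n) (if i != k then lam i * pRV X i w else 0).
    by apply/funext => w; rewrite /S big_mkcond.
  apply: measurable_sum => i; case ik: (i != k); last exact: measurable_cst.
  by apply: measurable_funM; [exact: measurable_cst|exact: mN].
have W0 w : 0 <= W w by apply: prodr_ge0 => i _; rewrite exprn_ge0// pRV_ge0.
have monE w : mon X nu w = pRV X k w ^+ m * W w by rewrite /mon (bigD1 k).
have wsumE w : wsum X lam w = lam k * pRV X k w + S w by rewrite /wsum (bigD1 k).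
pose h1 (z : measurableTypeR R * T') : R :=
  (a + m%:R) * pos z.1 ^+ m * pos (x - S z.2 - lam k * pos z.1) * W z.2.
pose h2 (z : measurableTypeR R * T') : R :=
  (b * pos z.1 ^+ m.+1 * pos (x - S z.2 - lam k * pos z.1) +
   lam k * pos z.1 ^+ m.+1 * (lam k * pos z.1 < x - S z.2)%R%:R) * W z.2.
have mfst : measurable_fun setT (fun z : measurableTypeR R * T' => z.1 : R).
  exact: measurable_fst.
have mp := measurable_pos mfst.
have mS2 : measurable_fun setT (fun z : measurableTypeR R * T' => S z.2).
  by apply: (measurableT_comp mS); exact: measurable_snd.
have mW2 : measurable_fun setT (fun z : measurableTypeR R * T' => W z.2).
  by apply: (measurableT_comp mW); exact: measurable_snd.
have mxS : measurable_fun setT (fun z : measurableTypeR R * T' => x - S z.2).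
  by apply: measurable_funB => //; exact: measurable_cst.
have mlp : measurable_fun setT (fun z : measurableTypeR R * T' => lam k * pos z.1).
  by apply: measurable_funM => //; exact: measurable_cst.
have mpp : measurable_fun setT (fun z : measurableTypeR R * T' => pos (x - S z.2 - lam k * pos z.1)).
  by apply/measurable_pos/measurable_funB.
have mh1 : measurable_fun setT (EFin \o h1).
  apply/measurable_EFinP; apply: measurable_funM => //; apply: measurable_funM => //.
  by apply: measurable_funM; [exact: measurable_cst|exact: measurable_funX].
have mh2 : measurable_fun setT (EFin \o h2).
  apply/measurable_EFinP; apply: measurable_funM => //; apply: measurable_funD.
    apply: measurable_funM => //.
    by apply: measurable_funM; [exact: measurable_cst|exact: measurable_funX].
  apply: measurable_funM; last exact: measurable_lt_ind.
  by apply: measurable_funM; [exact: measurable_cst|exact: measurable_funX].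
have h1_ge0 z : 0 <= h1 z.
  by rewrite /h1 !mulr_ge0 ?addr_ge0 ?exprn_ge0 ?pos_ge0 ?(ltW a0).
have h2_ge0 z : 0 <= h2 z.
  rewrite /h2 mulr_ge0// addr_ge0// !mulr_ge0 ?exprn_ge0 ?pos_ge0 ?(ltW b0)//.
  exact: ltW.
have E1 : (\int[P]_w ((a + m%:R) * (mon X nu w * pos (x - wsum X lam w)))%:E =
    \int[P]_w (EFin \o h1) (X k w, w))%E.
  apply: eq_integral => w _; rewrite /h1/= monE wsumE.
  by rewrite opprD addrA addrAC; congr EFin; rewrite /pRV; ring.
have E2 : (\int[P]_w (b * (mon X (raise nu k) w * pos (x - wsum X lam w)) +
      lam k * (mon X (raise nu k) w * (wsum X lam w < x)%R%:R))%:E =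
    \int[P]_w (EFin \o h2) (X k w, w))%E.
  apply: eq_integral => w _; rewrite /h2/= mon_raise monE wsumE ltrBrDr.
  by rewrite opprD addrA addrAC exprS; congr EFin; rewrite /pRV; ring.
rewrite /Rintegral E1 E2; congr fine.
rewrite (integral_split_RV indX mh1)// (integral_split_RV indX mh2)//.
apply: eq_integral => w _.
have lawE : forall V : set R, measurable V -> distribution P (RV_GR X k) V = gamma_prob a b V.
  by move=> V mV; exact: lawX.
have St := gamma_stein a0 b0 lawE m (x - S w) (lam0 k).
under eq_integral do rewrite /h1/= EFinM.
under [RHS]eq_integral do rewrite /h2/= EFinM.
have mt : measurable_fun setT (fun t : measurableTypeR R => pos (t : R)).
  by apply: (@measurable_pos _ _ (measurableTypeR R) (fun t => t)); exact: measurable_id.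
have mtX j : measurable_fun setT (fun t : measurableTypeR R => pos (t : R) ^+ j).
  exact: measurable_funX.
have mlt : measurable_fun setT (fun t : measurableTypeR R => lam k * pos (t : R)).
  by apply: measurable_funM => //; exact: measurable_cst.
have mct : measurable_fun setT
    (fun t : measurableTypeR R => pos (x - S w - lam k * pos (t : R))).
  by apply/measurable_pos/measurable_funB => //; exact: measurable_cst.
rewrite ge0_integralZr ?lee_fin//; last 2 first.
- by apply/measurable_EFinP/measurable_funM => //; apply: measurable_funM.
- by move=> t _; rewrite lee_fin !mulr_ge0 ?addr_ge0 ?exprn_ge0 ?pos_ge0 ?(ltW a0).
rewrite St ge0_integralZr ?lee_fin//.
- apply/measurable_EFinP/measurable_funD; apply: measurable_funM => //.
  + by apply: measurable_funM => //; exact: measurable_cst.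
  + by apply: measurable_funM => //; exact: measurable_cst.
  + by apply: measurable_lt_ind => //; exact: measurable_cst.
- move=> t _; rewrite lee_fin addr_ge0// !mulr_ge0 ?exprn_ge0 ?pos_ge0 ?(ltW b0)//.
  exact: ltW.
Qed.

End stein.

(** * Regularity of the truncated moments *)

Section derive_tools.
Context {R : realType}.
Implicit Types f K U : R -> R.

Lemma ndecr_derive_ge0 f (x df : R) : {homo f : y z / y <= z} -> is_derive x 1 f df -> 0 <= df.
Proof.
move=> fh /is_derive1_caratheodory[g [gE gc <-]]; rewrite leNgt; apply/negP => gx0.
have /= [e e0 eH] : \forall z \near x, g z < 0 by exact: (cvgr_lt _ gc).
have {}e0 : (0 : R) < e by [].
have xz : x < x + e / 2 by rewrite ltrDl divr_gt0.
have : g (x + e / 2) < 0.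
  apply: eH; rewrite /= opprD addrA subrr add0r normrN gtr0_norm ?divr_gt0//.
  by rewrite ltr_pdivrMr// ltr_pMr// ltr1n.
have := fh _ _ (ltW xz); rewrite -subr_ge0 gE addrAC subrr add0r pmulr_lge0 ?divr_gt0//.
by rewrite leNgt => /negP.
Qed.

Lemma subgrad_ndecr K U : (forall x y, (y - x) * U x <= K y - K x) -> {homo U : x y / x <= y}.
Proof.
move=> sub x y; rewrite le_eqVlt => /predU1P[->//|xy].
have h1 := sub x y; have h2 := sub y x.
rewrite -(@ler_pM2l _ (y - x)) ?subr_gt0// (le_trans h1)//.
by rewrite -lerN2 -mulNr !opprB.
Qed.

Lemma subgrad_continuous K U : (forall x y, (y - x) * U x <= K y - K x) -> continuous K.
Proof.
move=> sub x; have Uh := subgrad_ndecr sub.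
pose M := `|U (x - 1)| + `|U (x + 1)| + 1.
have M0 : 0 < M by rewrite ltr_wpDl.
apply/cvgrPdist_lt => e e0; near=> y.
have xy : `|x - y| < 1 by near: y; apply: (@cvgr_dist_lt _ R^o _ _ _ id x); [exact: cvg_id|exact: ltr01].
have xye : `|x - y| < e / M.
  by near: y; apply: (@cvgr_dist_lt _ R^o _ _ _ id x); [exact: cvg_id|exact: divr_gt0].
have UM z : x - 1 <= z -> z <= x + 1 -> `|U z| <= M.
  move=> /Uh zl /Uh zu; rewrite ler_norml; apply/andP; split.
    apply: le_trans zl; rewrite /M lerNl (le_trans (ler_norm _))// normrN.
    by rewrite -addrA lerDl addr_ge0.
  apply: (le_trans zu); rewrite /M (le_trans (ler_norm _))//.
  by rewrite addrAC lerDr addr_ge0.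
have [xy1 xy2] : x - 1 <= y /\ y <= x + 1.
  move: xy; rewrite ltr_norml => /andP[h1 h2]; split; lra.
suff : `|K x - K y| <= M * `|x - y|.
  by move/le_lt_trans; apply; rewrite mulrC -ltr_pdivlMr.
rewrite ler_norml; apply/andP; split.
  rewrite lerNl opprB; have := sub y x => h; rewrite -lerN2 opprB in h.
  apply: (le_trans h); rewrite -mulNr opprB.
  apply: (le_trans (ler_norm _)); rewrite normrM distrC mulrC ler_wpM2r//; exact: UM.
have := sub x y => h; rewrite -lerN2 opprB in h.
apply: (le_trans h); rewrite -mulNr opprB.
apply: (le_trans (ler_norm _)); rewrite normrM mulrC ler_wpM2r//.
by apply: UM; rewrite ?gerBl ?lerDl.
Unshelve. all: by end_near. Qed.

(** The difference quotient lies between [U x] and [U z] by the subgradient inequality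
    taken at both ends. *)
Lemma subgrad_derive K U (x : R) : (forall x y, (y - x) * U x <= K y - K x) ->
  {for x, continuous U} -> is_derive x 1 K (U x).
Proof.
move=> sub Uc; apply/is_derive1_caratheodory.
pose g z := if z == x then U x else (K z - K x) / (z - x).
exists g; split; last by rewrite /g eqxx.
- move=> z; rewrite /g; case: eqP => [->|/eqP zx]; first by rewrite !subrr mulr0.
  by rewrite divfK// subr_eq0.
- have gx : g x = U x by rewrite /g eqxx.
  have : g z @[z --> x] --> g x; last by []; rewrite gx; apply/cvgrPdist_lt => e e0.
  move/cvgrPdist_lt : Uc => /(_ e e0); apply: filterS => z Uz.
  rewrite /g; case: eqP => [_|/eqP zx]; first by rewrite subrr normr0.
  apply: le_lt_trans Uz.
  have h1 := sub x z; have h2 := sub z x.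
  have [xz|zx'|/eqP] := ltgtP x z; last by rewrite eq_sym (negPf zx).
  + have zx0 : 0 < z - x by rewrite subr_gt0.
    have l : U x <= (K z - K x) / (z - x) by rewrite ler_pdivlMr// mulrC.
    have u : (K z - K x) / (z - x) <= U z.
      by rewrite ler_pdivrMr// mulrC -lerN2 -mulNr !opprB.
    by rewrite !(distrC (U x)) !ger0_norm ?subr_ge0 ?(le_trans l u)// lerB.
  + have zx0 : 0 < x - z by rewrite subr_gt0.
    have E : (K z - K x) / (z - x) = (K x - K z) / (x - z).
      by rewrite -[in LHS](opprB (K x)) -[in LHS](opprB x z) invrN mulrNN.
    have u : (K x - K z) / (x - z) <= U x.
      by rewrite ler_pdivrMr// mulrC -lerN2 -mulNr !opprB.
    have l : U z <= (K x - K z) / (x - z) by rewrite ler_pdivlMr// mulrC.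
    by rewrite E !ger0_norm ?subr_ge0 ?(le_trans l u)// lerB.
Qed.

End derive_tools.

Lemma continuous_at_sum {R : realType} n (h : 'I_n -> R -> R) (x : R) :
  (forall k, {for x, continuous (h k)}) -> {for x, continuous (fun y => \sum_(k < n) h k y)}.
Proof.
elim: n h => [|n IHn] h hc.
  rewrite (_ : (fun y => _) = cst 0); first exact: cst_continuous.
  by apply/funext => y; rewrite big_ord0.
rewrite (_ : (fun y => _) = h ord0 + (fun y => \sum_(k < n) h (lift ord0 k) y)).
  by apply: continuousD; [exact: hc|apply: IHn => k; exact: hc].
by apply/funext => y; rewrite big_ord_recl.
Qed.

Section densities.
Context {R : realType} d (T : measurableType d) (P : probability T R) (n : nat)
  (X : 'I_n -> {RV P >-> R}) (a b : R).
Hypotheses (a0 : 0 < a) (b0 : 0 < b) (iidX : iid_gamma X a b).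
Variable lam : 'I_n -> R.
Hypothesis lam0 : forall i, 0 < lam i.
Local Notation U := (ltmom X lam).
Local Notation K := (posmom X lam).
Implicit Types (nu : 'I_n -> nat) (i j k : 'I_n) (x : R).
Let sub nu := posmom_subgrad X lam0 nu.

Lemma ltmom_ge0 nu x : 0 <= U nu x.
Proof. by apply: Rintegral_ge0 => w _; rewrite mulr_ge0 ?mon_ge0. Qed.

Lemma ltmom_ndecr nu : {homo U nu : x y / x <= y}.
Proof. exact: subgrad_ndecr (sub nu). Qed.

Lemma wsum_nneg w : 0 <= wsum X lam w.
Proof. by apply: wsum_ge0 => i; exact: ltW. Qed.

Lemma ltmom_eq0 nu x : x <= 0 -> U nu x = 0.
Proof.
move=> x0; rewrite /ltmom /Rintegral integral0_eq// => w _.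
by rewrite ltNge (le_trans x0) ?wsum_nneg// mulr0.
Qed.

Lemma posmom_eq0 nu x : x <= 0 -> K nu x = 0.
Proof.
move=> x0; rewrite /posmom /Rintegral integral0_eq// => w _.
by rewrite pos0 ?mulr0// subr_le0 (le_trans x0) ?wsum_nneg.
Qed.

Lemma ltmom_raiseE nu k x :
  U (raise nu k) x = ((a + (nu k)%:R) * K nu x - b * K (raise nu k) x) / lam k.
Proof.
rewrite (posmom_stein a0 b0 iidX lam0) addrAC subrr add0r mulrC mulKf//.
by rewrite gt_eqF.
Qed.

(** The identity [posmom_stein] expresses a raised moment through convex, hence continuous,
    functions of [x]. *)
Lemma ltmom_raise_cont nu k : continuous (U (raise nu k)).
Proof.
rewrite (_ : U (raise nu k) = fun x => ((a + (nu k)%:R) * K nu x - b * K (raise nu k) x) / lam k).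
  move=> x; apply: cvgMl; apply: cvgB; apply: cvgMr; exact: (subgrad_continuous (sub _)).
by apply/funext => x; exact: ltmom_raiseE.
Qed.

(** With no raised power, [posmom_stein] gives nothing; away from [0], [posmom_ltmom]
    expresses the moment through [K] and raised moments. *)
Lemma ltmom_cont nu x : 0 < x -> {for x, continuous (U nu)}.
Proof.
move=> x0.
have E y : 0 < y -> U nu y = (K nu y + \sum_(k < n) lam k * U (raise nu k) y) / y.
  by move=> y0; rewrite (posmom_ltmom X lam0) subrK mulrC mulKf// gt_eqF.
have cE : {for x, continuous (fun y : R => (K nu y + \sum_(k < n) lam k * U (raise nu k) y) / y)}.
  apply: cvgM; last by apply: cvgV; [rewrite gt_eqF|exact: cvg_id].
  apply: cvgD; first exact: (subgrad_continuous (sub nu)).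
  apply: continuous_at_sum => k; apply: cvgMr; exact: ltmom_raise_cont.
have : U nu y @[y --> x] --> U nu x; last by [].
rewrite E//; apply: cvg_trans cE; apply: near_eq_cvg.
near=> y; rewrite E//; near: y; exact: lt_nbhsr.
Unshelve. all: by end_near. Qed.

Lemma posmom_derive nu x : {for x, continuous (U nu)} -> is_derive x 1 (K nu) (U nu x).
Proof. exact: subgrad_derive (sub nu). Qed.

Lemma ltmom_derive nu k x : {for x, continuous (U nu)} ->
  is_derive x 1 (U (raise nu k)) (((a + (nu k)%:R) * U nu x - b * U (raise nu k) x) / lam k).
Proof.
move=> Uc.
rewrite (_ : U (raise nu k) = fun x => ((a + (nu k)%:R) * K nu x - b * K (raise nu k) x) / lam k); last first.
  by apply/funext => y; exact: ltmom_raiseE.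
rewrite -ltmom_raiseE.
have H1 := posmom_derive Uc.
have H2 := posmom_derive (@ltmom_raise_cont nu k x).
exact: is_derive_relax H1 H2.
Qed.

Definition dens nu : R -> R := derive1 (U nu).

Lemma densE nu k x : {for x, continuous (U nu)} ->
  dens (raise nu k) x = ((a + (nu k)%:R) * U nu x - b * U (raise nu k) x) / lam k.
Proof. by move=> Uc; rewrite /dens derive1E; have [_ ->] := ltmom_derive k Uc. Qed.

Lemma ltmom_derive_dens nu k x : {for x, continuous (U nu)} ->
  is_derive x 1 (U (raise nu k)) (dens (raise nu k) x).
Proof. by move=> Uc; rewrite densE//; exact: ltmom_derive. Qed.

Lemma dens_ge0 nu k x : {for x, continuous (U nu)} -> 0 <= dens (raise nu k) x.
Proof.
by move=> /(ltmom_derive_dens k); apply: ndecr_derive_ge0; exact: ltmom_ndecr.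
Qed.

Section two.
Variables (nu : 'I_n -> nat) (i j : 'I_n).
Let mu := raise (raise nu i) j.

(** One raised power gives continuity, a second one a continuous derivative. *)
Lemma dens2E x : dens mu x =
  ((a + (raise nu i j)%:R) * U (raise nu i) x - b * U mu x) / lam j.
Proof. by apply: densE; exact: ltmom_raise_cont. Qed.

Lemma dens2_cont : continuous (dens mu).
Proof.
rewrite (_ : dens mu = fun x =>
  ((a + (raise nu i j)%:R) * U (raise nu i) x - b * U mu x) / lam j).
  by move=> x; apply: cvgMl; apply: cvgB; apply: cvgMr; exact: ltmom_raise_cont.
by apply/funext => x; exact: dens2E.
Qed.

Lemma dens2_eq0 x : x <= 0 -> dens mu x = 0.
Proof. by move=> x0; rewrite dens2E !ltmom_eq0// !mulr0 subrr mul0r. Qed.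

Lemma dens2_raise_derive k x :
  is_derive x 1 (dens (raise mu k)) (((a + (mu k)%:R) * dens mu x - b * dens (raise mu k) x) / lam k).
Proof.
rewrite [X in is_derive _ _ X _](_ : _ = fun x =>
   ((a + (mu k)%:R) * U mu x - b * U (raise mu k) x) / lam k); last first.
  by apply/funext => y; apply: densE; exact: ltmom_raise_cont.
have H1 : is_derive x 1 (U mu) (dens mu x).
  by apply: ltmom_derive_dens; exact: ltmom_raise_cont.
have H2 : is_derive x 1 (U (raise mu k)) (dens (raise mu k) x).
  by apply: ltmom_derive_dens; exact: ltmom_raise_cont.
exact: is_derive_relax H1 H2.
Qed.

(** Both sides of [posmom_ltmom] are differentiated. *)
Lemma dens2_moment x : x * dens mu x = \sum_(k < n) lam k * dens (raise mu k) x.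
Proof.
have dU : is_derive x 1 (U mu) (dens mu x).
  by apply: ltmom_derive_dens; exact: ltmom_raise_cont.
have dK : is_derive x 1 (K mu) (U mu x).
  by apply: posmom_derive; exact: ltmom_raise_cont.
have dS : is_derive x 1 (fun y => \sum_(k < n) lam k * U (raise mu k) y)
    (\sum_(k < n) lam k * dens (raise mu k) x).
  apply: (is_derive_lincomb lam) => k.
  by apply: ltmom_derive_dens; exact: ltmom_raise_cont.
have dK2 : is_derive x 1 (K mu) (x * dens mu x + U mu x - \sum_(k < n) lam k * dens (raise mu k) x).
  rewrite (_ : K mu = fun y => y * U mu y - \sum_(k < n) lam k * U (raise mu k) y).
    have := is_deriveB (is_deriveM (is_derive_id x 1) dU) dS.
    by rewrite /GRing.scale/= mulr1.
  by apply/funext => y; exact: posmom_ltmom.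
have [_ E1] := dK; have [_] := dK2; rewrite E1 => /eqP.
by rewrite addrAC -subr_eq subrr eq_sym subr_eq0 => /eqP.
Qed.

End two.
End densities.

(** * Positivity, and the density with two raised shapes *)

Section gamma_law_pos.
Context {R : realType} (a b : R).
Hypothesis b0 : 0 < b.
Local Notation GR := (measurableTypeR R).
Variable nu : probability GR R.
Hypothesis nuE : forall V : set R, measurable V -> nu V = gamma_prob a b V.
Local Notation leb := (@lebesgue_measure R).

(** The density is positive on [(0, e)], which has positive length. *)
Lemma gamma_law_lt_gt0 (e : R) : 0 < e -> (0 < nu [set x : R | (x < e)%R])%E.
Proof.
move=> e0.
have mlt : measurable [set x : R | x < e] by rewrite -set_itvNyo.
rewrite lt0e measure_ge0 andbT; apply/negP => /eqP.
rewrite nuE// /gamma_prob => I0.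
have mp : measurable_fun [set x : GR | x < e] (fun x => (gamma_pdf a b x)%:E).
  by apply/measurable_EFinP; apply: measurable_funTS; exact: measurable_gamma_pdf.
have abs0 : (\int[leb]_(x in [set x : R | (x < e)%R]) `|(gamma_pdf a b x)%:E| = 0)%E.
  by rewrite -[RHS]I0; apply: eq_integral => x _; rewrite gee0_abs// lee_fin (gamma_pdf_ge0 nuE).
have [N [mN N0 sN]] := (ae_eq_integral_abs leb mlt mp).1 abs0.
have : (leb `]0%R, e[%classic <= leb N)%E.
  apply: le_measure; rewrite ?inE//.
  move=> x /=; rewrite in_itv/= => /andP[x0 xe]; apply: sN => /= /(_ xe) [].
  by apply/eqP; rewrite gt_eqF// (gamma_pdf_gt0 b0 nuE).
by rewrite N0 lebesgue_measure_itv/= lte_fin e0 oppr0 adde0 leNgt lte_fin e0.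
Qed.

End gamma_law_pos.

Lemma gamma_family_scale {R : realType} n (a th : 'I_n -> R) f g (c : R) : 0 < c ->
  gamma_family a th f g -> gamma_family a th (fun x => c * f x) (fun k x => c * g k x).
Proof.
move=> c0 [a0 th0 fc f0 fp g0 gd eqn]; split => //.
- by move=> x; apply: cvgMr; exact: fc.
- by move=> x x0; rewrite f0// mulr0.
- by move=> x x0; rewrite mulr_gt0// fp.
- by move=> k x x0; rewrite g0// mulr0.
- move=> k x; have H := is_deriveM (is_derive_cst c x 1) (gd k x).
  apply: (is_derive_eq H); rewrite /GRing.scale/= mulr0 addr0.
  by rewrite -mulrBr mulrA.
- move=> x; rewrite mulrCA eqn mulr_sumr; apply: eq_bigr => k _.
  by rewrite mulrCA.
Qed.

Section positivity.
Context {R : realType} d (T : measurableType d) (P : probability T R) (n : nat)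
  (X : 'I_n -> {RV P >-> R}).

Lemma measurable_wsum_lt (lam : 'I_n -> R) (x : R) : measurable [set w | wsum X lam w < x].
Proof.
rewrite (_ : [set w | _] = wsum X lam @^-1` `]-oo, x[); last first.
  by apply/seteqP; split => w /=; rewrite in_itv.
by rewrite -[X in measurable X]setTI; apply: measurable_wsum.
Qed.

Lemma mon0 w : mon X (fun _ => 0%N) w = 1.
Proof. by rewrite /mon big1. Qed.

Lemma prob_wsumE (lam : 'I_n -> R) (x : R) :
  P [set w | wsum X lam w < x] = (ltmom X lam (fun _ => 0%N) x)%:E.
Proof.
have mYx := measurable_wsum_lt lam x.
rewrite /ltmom /Rintegral.
rewrite (eq_integral (fun w => (\1_[set w | wsum X lam w < x] w)%:E)); last first.
  by move=> w _; rewrite mon0 mul1r indicE mem_setE.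
by rewrite integral_indic// setIT fineK// fin_num_measure.
Qed.

Variables (a b : R).
Hypotheses (a0 : 0 < a) (b0 : 0 < b) (iidX : iid_gamma X a b).
Variable lam : 'I_n -> R.
Hypothesis lam0 : forall i, 0 < lam i.
Local Notation U := (ltmom X lam).
Local Notation K := (posmom X lam).

(** By independence, all variables are simultaneously small with positive probability. *)
Lemma ltmom0_gt0 (x : R) : 0 < x -> 0 < U (fun _ => 0%N) x.
Proof.
move=> x0; rewrite -lte_fin -prob_wsumE.
have [indX lawX] := iidX.
have s1 : 0 < \sum_(i < n) lam i + 1.
  by rewrite ltr_wpDl// sumr_ge0// => i _; exact: ltW.
pose e := x / (\sum_(i < n) lam i + 1).
have e0 : 0 < e by exact: divr_gt0.
have mlt : measurable [set y : R | y < e] by rewrite -set_itvNyo.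
have E := indX [set: 'I_n]%SET (fun=> [set y : R | y < e]) (fun _ => mlt).
have : (0 < P (\bigcap_(i in [set` [set: 'I_n]%SET]) X i @^-1` [set y | (y < e)%R]))%E.
  rewrite E; apply: (big_ind (fun y : \bar R => 0 < y)%E) => [||i _].
  - exact: lte01.
  - by move=> y z y0 z0; exact: mule_gt0.
  have lawE (V : set R) : measurable V -> distribution P (RV_GR X i) V = gamma_prob a b V.
    exact: lawX.
  exact: (gamma_law_lt_gt0 b0 lawE).
move=> /lt_le_trans; apply; apply: le_measure; rewrite ?inE//.
- apply: fin_bigcap_measurable => // i _; exact: measurable_RV_preimage.
- exact: measurable_wsum_lt.
move=> w Xw /=.
have Xe i : pRV X i w <= e.
  rewrite /pRV /pos ge_max (ltW e0) andbT ltW//.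
  by apply: (Xw i); rewrite /= inE.
apply: (@le_lt_trans _ _ (\sum_(i < n) lam i * e)).
  by apply: ler_sum => i _; rewrite ler_pM2l.
by rewrite -mulr_suml /e mulrCA gtr_pMr// ltr_pdivrMr// mul1r ltrDl.
Qed.

Lemma ltmom_gt0_step nu k : (forall x, 0 < x -> 0 < U nu x) ->
  forall x, 0 < x -> 0 < U (raise nu k) x.
Proof.
move=> Ugt0 x x0; rewrite lt_neqAle ltmom_ge0 andbT; apply/negP => /eqP Ur.
have sub nu' := posmom_subgrad X lam0 nu'.
have x20 : 0 < x / 2 by rewrite divr_gt0.
have Kr : K (raise nu k) x <= 0.
  have := sub (raise nu k) x 0; rewrite -Ur mulr0 (posmom_eq0 _ lam0 _ (lexx 0)) sub0r.
  by rewrite oppr_ge0.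
have Kn : 0 < K nu x.
  have h1 := sub nu (x / 2) x.
  have h2 := sub nu 0 (x / 2).
  rewrite (ltmom_eq0 _ lam0 _ (lexx 0)) mulr0 (posmom_eq0 _ lam0 _ (lexx 0)) subr0 in h2.
  have h3 : 0 < (x - x / 2) * U nu (x / 2) by rewrite mulr_gt0 ?Ugt0//; lra.
  lra.
have := posmom_stein a0 b0 iidX lam0 nu k x.
rewrite -Ur mulr0 addr0 => E.
have : 0 < (a + (nu k)%:R) * K nu x by rewrite mulr_gt0// ltr_wpDr.
by rewrite E pmulr_rgt0// ltNge Kr.
Qed.

(** If the density vanished at [x], then by [relax_pos] it would be nonpositive on
    [(0, x)], and its antiderivative could not be positive at [x]. *)
Lemma dens_gt0_step nu i j k x : (forall x, 0 < x -> 0 < U (raise (raise (raise nu i) j) k) x) ->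
  0 < x -> 0 < dens X lam (raise (raise (raise nu i) j) k) x.
Proof.
set mu := raise (raise nu i) j => Upos x0.
rewrite ltNge; apply/negP => fx.
have fle t : 0 < t -> t < x -> dens X lam (raise mu k) t <= 0.
  move=> t0 tx; rewrite leNgt; apply/negP => ft.
  suff : 0 < dens X lam (raise mu k) x by rewrite ltNge fx.
  have dd (y : R) := dens2_raise_derive a0 b0 iidX lam0 nu i j k y.
  apply: (relax_pos (c := lam k / b) _ (ltW tx) (fun y _ => dd y) _ _ ft).
  - exact: divr_gt0.
  - apply: continuous_subspaceT => y; exact: is_derive_continuous (dd y).
  - move=> y _; rewrite -/mu.
    have alg (A D E l : R) : l != 0 -> E + l / b * ((A * D - b * E) / l) = A / b * D.
      by move=> l0; field; rewrite l0 gt_eqF.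
    rewrite alg ?gt_eqF//.
    apply: mulr_ge0; first by rewrite divr_ge0 ?(ltW b0)// addr_ge0 ?(ltW a0).
    by apply: (dens_ge0 a0 b0 iidX lam0); exact: (ltmom_raise_cont a0 b0 iidX lam0).
have dU (y : R) : is_derive y 1 (U (raise mu k)) (dens X lam (raise mu k) y).
  by apply: (ltmom_derive_dens a0 b0 iidX lam0); exact: (ltmom_raise_cont a0 b0 iidX lam0).
have Uc : {within `[0, x], continuous (U (raise mu k))}.
  by apply: continuous_subspaceT => y; exact: is_derive_continuous (dU y).
have [y] := MVT x0 (fun y _ => dU y) Uc.
rewrite in_itv/= => /andP[y0 yx]; rewrite (ltmom_eq0 _ lam0 _ (lexx 0)) !subr0 => E.
by have := Upos x x0; rewrite E pmulr_lgt0// ltNge fle.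
Qed.

Lemma dens2_gt0 nu i j x : (forall k x, 0 < x -> 0 < U (raise (raise (raise nu i) j) k) x) ->
  0 < x -> 0 < dens X lam (raise (raise nu i) j) x.
Proof.
move=> Upos x0; rewrite -(pmulr_rgt0 _ x0) (dens2_moment a0 b0 iidX lam0).
have f0 k : 0 < lam k * dens X lam (raise (raise (raise nu i) j) k) x.
  by rewrite mulr_gt0// dens_gt0_step// => y y0; exact: Upos.
by apply: (@sumr_gt0 _ _ _ i) => // k; exact: ltW.
Qed.

(** Raising [mu k] multiplies the total mass by [(a + mu k) / b], the mean of a gamma
    variable of shape [a + mu k]; the factor in front of [dens] compensates for it. *)
Lemma gamma_family_dens nu i j (mu := raise (raise nu i) j) :
  (forall nu x, 0 < x -> 0 < U nu x) ->
  gamma_family (fun k => a + (mu k)%:R) (fun k => lam k / b)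
    (dens X lam mu) (fun k x => b / (a + (mu k)%:R) * dens X lam (raise mu k) x).
Proof.
move=> Upos.
have am0 k : 0 < a + (mu k)%:R by rewrite ltr_wpDr.
split.
- exact: am0.
- by move=> k; exact: divr_gt0.
- exact: (dens2_cont a0 b0 iidX lam0).
- exact: (dens2_eq0 a0 b0 iidX lam0).
- by move=> x x0; apply: dens2_gt0 => // k y; exact: Upos.
- by move=> k x x0; rewrite (dens2_eq0 a0 b0 iidX lam0) ?mulr0.
- move=> k x; have H := is_deriveM (is_derive_cst (b / (a + (mu k)%:R)) x 1)
    (dens2_raise_derive a0 b0 iidX lam0 nu i j k x).
  apply: (is_derive_eq H); rewrite /GRing.scale/= mulr0 addr0 -/mu.
  have alg (A D E l : R) : A != 0 -> l != 0 ->
      b / A * ((A * D - b * E) / l) = (D - b / A * E) / (l / b).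
    by move=> A0 l0; field; rewrite A0 l0 gt_eqF.
  by rewrite alg ?gt_eqF.
- move=> x; rewrite (dens2_moment a0 b0 iidX lam0); apply: eq_bigr => k _.
  by field; rewrite !gt_eqF.
Qed.

End positivity.

Section pair_density.
Context {R : realType} d (T : measurableType d) (P : probability T R) (n : nat)
  (X : 'I_n -> {RV P >-> R}) (a b : R).
Hypotheses (a0 : 0 < a) (b0 : 0 < b) (iidX : iid_gamma X a b).

Lemma ltmom_gt0 (lam : 'I_n -> R) : (forall i, 0 < lam i) ->
  forall nu x, 0 < x -> 0 < ltmom X lam nu x.
Proof.
move=> lam0 nu; elim: (\sum_i nu i)%N {-2}nu (erefl (\sum_i nu i)%N) => {nu} [nu nu0 x x0|m IHm nu nuE].
  rewrite (_ : nu = fun _ => 0%N); first exact: (ltmom0_gt0 b0 iidX lam0).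
  apply/funext => i; apply/eqP; rewrite -leqn0.
  by move/eqP: nu0; rewrite sum_nat_eq0 => /forallP/(_ i)/implyP/(_ isT)/eqP ->.
have [k nuk] : exists k, (0 < nu k)%N.
  apply: contrapT => /forallNP nk; have : (\sum_i nu i = 0)%N.
    by apply: big1 => i _; have := nk i; case: (nu i).
  by rewrite nuE.
pose nu' i := (nu i - (i == k))%N.
have nuE' : nu = raise nu' k.
  apply/funext => i; rewrite /raise /nu'; case: eqP => [->|_] /=; first by rewrite subnK.
  by rewrite subn0 addn0.
rewrite nuE'; apply: (ltmom_gt0_step a0 b0 iidX lam0) => x x0; apply: IHm => //.
have k1 : (\sum_(i < n) (i == k) = 1)%N.
  by rewrite (bigD1 k)//= eqxx big1// => i /negPf ->.
by move: nuE; rewrite nuE' /raise big_split/= k1 addn1 => -[].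
Qed.

Variables (i j : 'I_n).
Hypothesis ij : i != j.
Definition unit_index (k : 'I_n) : 'I_n -> nat := raise (fun _ => 0%N) k.
Definition pair_index : 'I_n -> nat := raise (unit_index i) j.
Local Notation pairdens lam := (dens X lam pair_index).

Lemma pair_shapeE : (fun k => a + (pair_index k)%:R) = pair_shape a i j.
Proof.
by apply/funext => k; rewrite /pair_index /unit_index /raise /pair_shape add0n natrD addrA.
Qed.

Section fixed_weights.
Variable lam : 'I_n -> R.
Hypothesis lam0 : forall i, 0 < lam i.
Let th k := lam k / b.
Let s := \sum_(k < n) lam k.

Let sthE : \sum_(k < n) th k = s / b. Proof. by rewrite mulr_suml. Qed.

Let fam : gamma_family (pair_shape a i j) th (pairdens lam)
  (fun k x => b / (a + (pair_index k)%:R) * dens X lam (raise pair_index k) x).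
Proof.
rewrite -pair_shapeE; apply: (gamma_family_dens a0 b0 iidX lam0).
exact: ltmom_gt0.
Qed.

Let fam2 k : exists h, gamma_family (fun m => pair_shape a i j m + (m == k)%:R) th
  (fun x => b / (a + (pair_index k)%:R) * dens X lam (raise pair_index k) x) h.
Proof.
have F := gamma_family_dens a0 b0 iidX lam0 (unit_index i) j k (ltmom_gt0 lam0).
have c0 : 0 < b / (a + (pair_index k)%:R) by rewrite divr_gt0// ltr_wpDr.
have := gamma_family_scale c0 F.
rewrite (_ : (fun m => a + _) = fun m => pair_shape a i j m + (m == k)%:R).
  by move=> H; eexists; exact: H.
by apply/funext => m; rewrite -pair_shapeE /raise natrD addrA.
Qed.

Lemma pairdens_nonincr x y : (a + 2^-1) * s / b <= x -> x <= y -> pairdens lam y <= pairdens lam x.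
Proof.
by move=> sx; apply: (gf_nonincr_above a0 ij fam fam2); rewrite sthE mulrA.
Qed.

Lemma pairdens_ndecr x y : 0 <= x -> x <= y ->
  y <= ((a - 1) * s + lam i + lam j) / b -> pairdens lam x <= pairdens lam y.
Proof.
move=> x0 xy yB; apply: (gf_ndecr_pair fam x0 xy).
by apply: (le_trans yB); rewrite sthE /th !mulrDl !mulrA.
Qed.

(** The derivative of the moment with [i] and [j] raised can be computed by raising
    either one last; eliminating the moment itself between the two expressions leaves
    the difference of the first moments. *)
Lemma ltmom_unit_diff x : ltmom X lam (unit_index i) x - ltmom X lam (unit_index j) x =
  - ((lam i - lam j) / a * pairdens lam x).
Proof.
have cont k : {for x, continuous (ltmom X lam (unit_index k))}.
  exact: (ltmom_raise_cont a0 b0 iidX lam0).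
have E1 := densE a0 b0 iidX lam0 j (cont i).
have E2 := densE a0 b0 iidX lam0 i (cont j).
have sw : raise (unit_index j) i = pair_index.
  by apply/funext => k; rewrite /pair_index /unit_index /raise addnAC.
rewrite sw in E2.
have ui : unit_index i j = 0%N by rewrite /unit_index /raise eq_sym (negPf ij).
have uj : unit_index j i = 0%N by rewrite /unit_index /raise (negPf ij).
rewrite -/pair_index ui addr0 in E1; rewrite uj addr0 in E2.
have {}E1 := congr1 ( *%R^~ (lam j)) E1; rewrite /= divfK ?gt_eqF// in E1.
have {}E2 := congr1 ( *%R^~ (lam i)) E2; rewrite /= divfK ?gt_eqF// in E2.
apply: (mulfI (lt0r_neq0 a0)).
rewrite mulrN mulrCA mulrA divfK ?gt_eqF// mulrBr mulrBl.
by move: E1 E2; lra.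
Qed.

End fixed_weights.
End pair_density.

(** * Transfers between two weights *)

Section subgrad_path.
Context {R : realType}.

Lemma harmonic_le0 (c z : R) : (forall N : nat, c / N.+1%:R <= z) -> 0 <= z.
Proof.
move=> H; rewrite leNgt; apply/negP => z0.
have [N _ /(_ N (leqnn N)) /=] : \forall N \near \oo, `|c| / N.+1%:R < - z.
  have : (fun N : nat => `|c| * N.+1%:R^-1) @ \oo --> `|c| * 0.
    by apply: cvgMr; exact: cvg_harmonic.
  by rewrite mulr0 => /cvgr_lt; apply; rewrite oppr_gt0.
have := H N; rewrite ltrNr => h1 h2.
have : - (`|c| / N.+1%:R) <= c / N.+1%:R.
  by rewrite -mulNr ler_pM2r ?invr_gt0// lerNl -normrN ler_norm.
by move=> h3; have := lt_le_trans h2 (le_trans h3 h1); rewrite ltxx.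
Qed.

(** An integrated comparison of derivatives in which [DA] and [DB] need only be
    subgradients: summing over a grid with mesh [e / N.+1], the error telescopes to
    [O (1 / N)] and disappears in the limit. *)
Lemma subgrad_path (A B DA DB : R -> R) (e : R) : 0 <= e ->
  (forall t t', 0 <= t -> t <= e -> 0 <= t' -> t' <= e -> (t' - t) * DA t <= A t' - A t) ->
  (forall t t', 0 <= t -> t <= e -> 0 <= t' -> t' <= e -> (t' - t) * DB t <= B t' - B t) ->
  (forall t, 0 <= t -> t <= e -> DB t <= DA t) ->
  B e - B 0 <= A e - A 0.
Proof.
move=> e0 hA hB hD; rewrite -subr_ge0.
apply: (@harmonic_le0 (e * (DB 0 - DB e))) => N.
pose h := e / N.+1%:R.
have h0 : 0 <= h by rewrite divr_ge0.
pose t (m : nat) := m%:R * h.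
have t0 m : 0 <= t m by rewrite mulr_ge0.
have tN : t N.+1 = e by rewrite /t /h mulrC divfK// pnatr_eq0.
have te m : (m <= N.+1)%N -> t m <= e by move=> mN; rewrite -tN ler_wpM2r// ler_nat.
have tS m : t m.+1 - t m = h by rewrite /t -mulrBl -natrB// subSnn mul1r.
have tS' m : t m - t m.+1 = - h by rewrite -opprB tS.
have key m : (m <= N.+1)%N -> h * (DB 0 - DB (t m)) <= (A (t m) - A (t 0%N)) - (B (t m) - B (t 0%N)).
  elim: m => [_|m IHm mN]; first by rewrite {1}/t mul0r !subrr mulr0.
  have mN' := ltnW mN.
  have := IHm mN'.
  have := hA (t m) (t m.+1) (t0 _) (te _ mN') (t0 _) (te _ mN); rewrite tS.
  have := hB (t m.+1) (t m) (t0 _) (te _ mN) (t0 _) (te _ mN'); rewrite tS'.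
  have := ler_wpM2l h0 (hD (t m) (t0 _) (te _ mN')).
  rewrite !mulrBr; lra.
have := key N.+1 (leqnn _); rewrite tN {1 2}/t mul0r.
by rewrite mulrAC -/h.
Qed.

End subgrad_path.

Section transfers.
Context {R : realType} d (T : measurableType d) (P : probability T R) (n : nat)
  (X : 'I_n -> {RV P >-> R}) (a b : R).
Hypotheses (a0 : 0 < a) (b0 : 0 < b) (iidX : iid_gamma X a b).
Local Notation zero_index := (fun _ : 'I_n => 0%N).

Lemma mon_unit k w : mon X (unit_index k) w = pRV X k w.
Proof. by rewrite /unit_index mon_raise mon0 mulr1. Qed.

(** The positive part is convex, and [wsum] is linear in the weights. *)
Lemma posmom_weight_subgrad (lam lam' : 'I_n -> R) x :
  (forall k, 0 < lam k) -> (forall k, 0 < lam' k) ->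
  \sum_(k < n) (lam k - lam' k) * ltmom X lam (unit_index k) x <=
  posmom X lam' zero_index x - posmom X lam zero_index x.
Proof.
move=> lam0 lam'0.
have i1 k := integrable_ltmom X lam0 (unit_index k) x.
have i2 := integrable_posmom X lam0 zero_index x.
have i3 := integrable_posmom X lam'0 zero_index x.
rewrite /ltmom; under eq_bigr do rewrite -RintegralZl//.
rewrite -Rintegral_sum => [|k]; last exact: integrableZR.
rewrite /posmom -RintegralB//; apply: le_Rintegral => //.
- by apply: integrable_sumR => k; exact: integrableZR.
- exact: integrableBR.
move=> w _; rewrite mon0 !mul1r.
have := pos_subgrad x (x + wsum X lam w - wsum X lam' w) (wsum X lam w).
rewrite (_ : x + wsum X lam w - wsum X lam' w - wsum X lam w = x - wsum X lam' w); last ring.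
apply: le_trans.
rewrite (_ : x + _ - _ - x = wsum X lam w - wsum X lam' w); last ring.
rewrite /wsum -sumrB mulr_suml le_eqVlt; apply/orP; left; apply/eqP.
by apply: eq_bigr => k _; rewrite mon_unit mulrA mulrBl.
Qed.

Definition transfer (lam : 'I_n -> R) (i j : 'I_n) (t : R) : 'I_n -> R :=
  fun k => lam k - t * (k == i)%:R + t * (k == j)%:R.

Lemma transfer0 lam i j : transfer lam i j 0 = lam.
Proof. by apply/funext => k; rewrite /transfer !mul0r subr0 addr0. Qed.

Lemma sum_transfer lam i j t : \sum_(k < n) transfer lam i j t k = \sum_(k < n) lam k.
Proof.
have S i' : \sum_(k < n) t * (k == i')%:R = t.
  rewrite (bigD1 i')//= eqxx mulr1 big1 ?addr0// => k /negPf ->.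
  by rewrite mulr0.
by rewrite /transfer big_split/= sumrB !S subrK.
Qed.

Section one_transfer.
Variables (lam : 'I_n -> R) (i j : 'I_n) (e : R).
Hypotheses (lam0 : forall k, 0 < lam k) (ij : i != j) (e0 : 0 <= e)
  (le_e : lam j + e <= lam i - e).
Local Notation L t x := (posmom X (transfer lam i j t) zero_index x).
Let s := \sum_(k < n) lam k.

Lemma transfer_i t : transfer lam i j t i = lam i - t.
Proof. by rewrite /transfer eqxx (negPf ij) mulr1 mulr0 addr0. Qed.

Lemma transfer_j t : transfer lam i j t j = lam j + t.
Proof. by rewrite /transfer eqxx eq_sym (negPf ij) mulr1 mulr0 subr0. Qed.

Lemma transfer_gt0 t : 0 <= t -> t <= e -> forall k, 0 < transfer lam i j t k.
Proof.
move=> t0 te k; have [->|ki] := eqVneq k i.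
  rewrite transfer_i; move: (lam0 j) te e0 le_e; lra.
have [->|kj] := eqVneq k j; first by rewrite transfer_j ltr_pwDl.
by rewrite /transfer (negPf ki) (negPf kj) !mulr0 subr0 addr0.
Qed.

Let D t x := ltmom X (transfer lam i j t) (unit_index i) x - ltmom X (transfer lam i j t) (unit_index j) x.

Let L_subgrad x t t' : 0 <= t -> t <= e -> 0 <= t' -> t' <= e ->
  (t' - t) * D t x <= L t' x - L t x.
Proof.
move=> t0 te t'0 t'e.
apply: le_trans (posmom_weight_subgrad x (transfer_gt0 t0 te) (transfer_gt0 t'0 t'e)).
have E k : transfer lam i j t k - transfer lam i j t' k =
    (t' - t) * ((k == i)%:R - (k == j)%:R) by rewrite /transfer; ring.
under eq_bigr do rewrite E -mulrA.
rewrite -mulr_sumr; under eq_bigr do rewrite mulrBl.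
rewrite sumrB (bigD1 i)//= eqxx mul1r big1 ?addr0; last first.
  by move=> k /negPf ->; rewrite mul0r.
rewrite (bigD1 j)//= eqxx mul1r big1 ?addr0// => k /negPf ->.
by rewrite mul0r.
Qed.

(** The weight [i] stays the larger one along the whole transfer, hence the sign of [c]. *)
Let DE t : 0 <= t -> t <= e ->
  exists2 c, 0 <= c & forall x, D t x = - (c * dens X (transfer lam i j t) (pair_index i j) x).
Proof.
move=> t0 te; exists ((transfer lam i j t i - transfer lam i j t j) / a).
  rewrite divr_ge0 ?(ltW a0)// transfer_i transfer_j; move: te e0 le_e; lra.
by move=> y; rewrite /D (ltmom_unit_diff a0 b0 iidX ij (transfer_gt0 t0 te)).
Qed.

(** The derivative of the increment of [K] along the transfer is the
    increment of [- c * f], with [f] the pair density at the current weights; it is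
    nonnegative where all these densities decrease. *)
Lemma transfer_above x y : (a + 2^-1) * s / b <= x -> x <= y ->
  posmom X lam zero_index y - posmom X lam zero_index x <= L e y - L e x.
Proof.
move=> sx xy.
have := subgrad_path (A := fun t => L t y) (B := fun t => L t x) e0 (L_subgrad y) (L_subgrad x).
rewrite transfer0 => H; suff : L e x - posmom X lam zero_index x <= L e y - posmom X lam zero_index y by lra.
apply: H => t t0 te; have [c c0 E] := DE t0 te; rewrite !E lerN2 ler_wpM2l//.
apply: (pairdens_nonincr a0 b0 iidX ij (transfer_gt0 t0 te)) => //.
by rewrite sum_transfer.
Qed.

Lemma transfer_below x y : 0 <= x -> x <= y -> y <= ((a - 1) * s + lam i + lam j) / b ->
  L e y - L e x <= posmom X lam zero_index y - posmom X lam zero_index x.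
Proof.
move=> x0 xy ys.
have := subgrad_path (A := fun t => L t x) (B := fun t => L t y) e0 (L_subgrad x) (L_subgrad y).
rewrite transfer0 => H; suff : L e y - posmom X lam zero_index y <= L e x - posmom X lam zero_index x by lra.
apply: H => t t0 te; have [c c0 E] := DE t0 te; rewrite !E lerN2 ler_wpM2l//.
apply: (pairdens_ndecr a0 b0 iidX (transfer_gt0 t0 te)) => //.
apply: (le_trans ys); rewrite sum_transfer transfer_i transfer_j ler_pM2r ?invr_gt0//.
by rewrite -/s; lra.
Qed.

End one_transfer.
End transfers.

(** * Majorization as a chain of transfers *)

Section majorization.
Context {R : realType} (n : nat).

Lemma psum_transfer (lam : 'I_n -> R) (i j : 'I_n) (e : R) (m : nat) : (i < j)%N -> 0 <= e ->
  \sum_(k < n | (k < m)%N) transfer lam i j e k =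
  \sum_(k < n | (k < m)%N) lam k - e * (i < m <= j)%N%:R.
Proof.
move=> ij e0.
have S (k : 'I_n) : \sum_(k' < n | (k' < m)%N) e * (k' == k)%:R = e * (k < m)%N%:R.
  have [km|mk] := boolP (k < m)%N.
    rewrite (bigD1 k)//= eqxx mulr1 big1 ?addr0// => k' /andP[_ /negPf ->].
    by rewrite mulr0.
  rewrite mulr0 big1// => k' k'm; case: eqP => [k'k|]; last by rewrite mulr0.
  by move: mk; rewrite -k'k k'm.
rewrite /transfer big_split/= sumrB !S -addrA; congr (_ + _).
rewrite -mulrN -mulrDr -mulrN; congr (_ * _).
case: (ltnP i m) => im; case: (ltnP j m) => jm /=; rewrite ?oppr0 ?addr0 ?addNr//.
by have := leq_ltn_trans im (ltn_trans ij jm); rewrite ltnn.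
Qed.

(** Induction on the number of disagreeing entries.  If [l] is the first index where
    [lam] falls short of [mu], dominance of the partial sums yields an earlier index [k]
    with an excess; transferring the smaller of excess and shortage from [k] to [l]
    settles one of these entries and keeps the dominance. *)
Lemma transfer_majorization (F : ('I_n -> R) -> R) (mu lam : 'I_n -> R) :
  (forall nu (i j : 'I_n) e, (forall k, 0 < nu k) ->
     \sum_(k < n) nu k = \sum_(k < n) mu k -> i != j -> 0 <= e ->
     nu j + e <= nu i - e -> F nu <= F (transfer nu i j e)) ->
  (forall k, 0 < mu k) -> (forall i j : 'I_n, (i <= j)%N -> mu j <= mu i) ->
  (forall k, 0 < lam k) ->
  (forall m, \sum_(k < n | (k < m)%N) mu k <= \sum_(k < n | (k < m)%N) lam k) ->
  \sum_(k < n) mu k = \sum_(k < n) lam k ->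
  F lam <= F mu.
Proof.
move=> hF mu0 mudecr.
have [N] := ubnP #|[set k | lam k != mu k]%SET|.
elim: N lam => // N IHN lam + lam0 psum sum.
have [le _|ltN] := pselect (forall k, mu k <= lam k).
  suff -> : lam = mu by [].
  apply/funext => k; apply/eqP; rewrite -subr_eq0.
  have : \sum_(k < n) (lam k - mu k) = 0 by rewrite sumrB sum subrr.
  by move/psumr_eq0P => ->// i _; rewrite subr_ge0.
have [l0 l0P] : exists k, lam k < mu k.
  by move/existsNP: ltN => [k /negP]; rewrite -ltNge; exists k.
case: (@arg_minnP _ l0 (fun k => lam k < mu k) (fun k : 'I_n => val k) l0P) => l ll lmin cardN.
have below (i : 'I_n) : (i < l)%N -> mu i <= lam i.
  by move=> il; rewrite leNgt; apply/negP => /lmin; rewrite leqNgt il.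
have [k kl lk] : exists2 k : 'I_n, (k < l)%N & mu k < lam k.
  have [//|H] := pselect (exists2 k : 'I_n, (k < l)%N & mu k < lam k).
  have := psum l.+1; rewrite [leLHS](bigD1 l)//= [leRHS](bigD1 l)//= => Hl.
  have : \sum_(i < n | (i < l.+1)%N && (i != l)) lam i <=
         \sum_(i < n | (i < l.+1)%N && (i != l)) mu i.
    apply: ler_sum => i /andP[il il']; rewrite leNgt; apply/negP => mi.
    by apply: H; exists i => //; rewrite ltn_neqAle il'.
  by move: Hl ll; lra.
pose e := Num.min (lam k - mu k) (mu l - lam l).
have e0 : 0 < e by rewrite lt_min !subr_gt0 lk.
have ek : e <= lam k - mu k by rewrite ge_min lexx.
have el : e <= mu l - lam l by rewrite ge_min lexx orbT.
have kl' : k != l by apply: contraTneq kl => ->; rewrite ltnn.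
have gap : lam l + e <= lam k - e by have := mudecr k l (ltnW kl); move: ek el; lra.
apply: (le_trans (hF lam k l e lam0 (esym sum) kl' (ltW e0) gap)); apply: IHN.
- rewrite ltnS in cardN; apply: leq_trans cardN.
  apply: proper_card; apply/fintype.properP; split.
    apply/fintype.subsetP => i; rewrite !inE.
    have [->|ik] := eqVneq i k; first by rewrite (gt_eqF lk).
    have [->|il] := eqVneq i l; first by rewrite (lt_eqF ll).
    by rewrite /transfer (negPf ik) (negPf il) !mulr0 subr0 addr0.
  have [eE|eE] : e = lam k - mu k \/ e = mu l - lam l.
    by rewrite /e /Num.min; case: ifP; [left|right].
  + exists k; rewrite !inE ?(gt_eqF lk)// transfer_i// eE opprB addrCA subrr addr0.
    by rewrite eqxx.
  + by exists l; rewrite !inE ?(lt_eqF ll)// transfer_j// eE addrCA subrr addr0 eqxx.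
- exact: (transfer_gt0 lam0 kl' (ltW e0) gap (ltW e0) (lexx e)).
- move=> m; rewrite psum_transfer ?(ltW e0)//.
  have [/andP[km ml]|_] := boolP (k < m <= l)%N; last by rewrite mulr0 subr0.
  rewrite mulr1 (bigD1 k)//= [in leRHS](bigD1 k)//=.
  have : \sum_(i < n | (i < m)%N && (i != k)) mu i <=
         \sum_(i < n | (i < m)%N && (i != k)) lam i.
    by apply: ler_sum => i /andP[im _]; apply: below; exact: leq_trans im ml.
  by move: ek; lra.
- by rewrite sum_transfer.
Qed.

End majorization.

(** * Vanishing weights *)

Section nonneg_weights.
Context {R : realType} d (T : measurableType d) (P : probability T R) (n : nat)
  (X : 'I_n -> {RV P >-> R}).
Local Notation Phi lam := (ltmom X lam (fun _ => 0%N)).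
Local Notation K lam := (posmom X lam (fun _ => 0%N)).
Implicit Types lam mu : 'I_n -> R.

Definition mix lam mu (t : R) : 'I_n -> R := fun k => lam k + t * (mu k - lam k).

Lemma mixE lam mu t k : mix lam mu t k = (1 - t) * lam k + t * mu k.
Proof. by rewrite /mix; ring. Qed.

Lemma mix_ge0 lam mu t : (forall k, 0 <= lam k) -> (forall k, 0 <= mu k) -> 0 <= t -> t <= 1 ->
  forall k, 0 <= mix lam mu t k.
Proof. by move=> lam0 mu0 t0 t1 k; rewrite mixE addr_ge0// mulr_ge0// subr_ge0. Qed.

Lemma mix_gt0 lam mu t : (forall k, 0 <= lam k) -> (forall k, 0 < mu k) -> 0 < t -> t <= 1 ->
  forall k, 0 < mix lam mu t k.
Proof.
by move=> lam0 mu0 t0 t1 k; rewrite mixE ltr_wpDl ?mulr_gt0// mulr_ge0// subr_ge0.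
Qed.

Lemma wsum_mix lam mu t w :
  wsum X (mix lam mu t) w = wsum X lam w + t * (wsum X mu w - wsum X lam w).
Proof.
rewrite /wsum -sumrB mulr_sumr -big_split/=; apply: eq_bigr => k _.
by rewrite /mix; ring.
Qed.

Lemma continuous_pos : continuous (@pos R).
Proof. by move=> x; apply: (@continuous_max _ _ id (cst 0)); [exact: cvg_id|exact: cvg_cst]. Qed.

Lemma pos_sub_wsum lam x w : (forall k, 0 <= lam k) -> pos (x - wsum X lam w) <= `|x|.
Proof.
move=> lam0; rewrite /pos ge_max normr_ge0 andbT.
by rewrite (le_trans _ (ler_norm x))// gerBl wsum_ge0.
Qed.

Lemma integrable_posmom0 lam x : (forall k, 0 <= lam k) ->
  P.-integrable setT (EFin \o (fun w => mon X (fun _ => 0%N) w * pos (x - wsum X lam w))).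
Proof.
move=> lam0; apply: (@bounded_integrable _ _ _ _ _ `|x|); first exact: measurable_posmom.
by move=> w; rewrite mon0 mul1r pos_ge0/= pos_sub_wsum.
Qed.

Lemma posmom0_subgrad lam x y : (forall k, 0 <= lam k) ->
  (y - x) * Phi lam x <= K lam y - K lam x.
Proof.
move=> lam0.
have i1 : P.-integrable setT (EFin \o (fun w => mon X (fun _ => 0%N) w * (wsum X lam w < x)%R%:R)).
  apply: (@bounded_integrable _ _ _ _ _ 1); first exact: measurable_ltmom.
  by move=> w; rewrite mon0 mul1r ler0n lern1 leq_b1.
have ix := integrable_posmom0 x lam0; have iy := integrable_posmom0 y lam0.
rewrite /ltmom /posmom -RintegralZl// -RintegralB//.
apply: le_Rintegral => //; [exact: integrableZR|exact: integrableBR|].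
move=> w _; rewrite -mulrBr mulrCA ler_wpM2l ?mon_ge0//.
exact: pos_subgrad.
Qed.

(** The integrands are bounded by [`|x|], so dominated convergence applies. *)
Lemma posmom_mix_cvg lam mu x : (forall k, 0 <= lam k) -> (forall k, 0 <= mu k) ->
  K (mix lam mu N.+1%:R^-1) x @[N --> \oo] --> K lam x.
Proof.
move=> lam0 mu0.
have mK l := measurable_posmom X l (fun _ => 0%N) x.
have Hfin := integrable_fin_num measurableT (integrable_posmom0 x lam0).
rewrite /posmom /Rintegral; apply: fine_cvg; rewrite fineK//.
apply: (@dominated_cvg _ _ _ P setT measurableT
  (fun N w => (mon X (fun _ => 0%N) w * pos (x - wsum X (mix lam mu N.+1%:R^-1) w))%:E)
  (fun w => (mon X (fun _ => 0%N) w * pos (x - wsum X lam w))%:E) (cst `|x|%:E)) => //.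
- by move=> N; apply/measurable_EFinP; exact: mK.
- move=> w _; apply: cvg_EFin; first by near=> N.
  apply: cvgMl_tmp; apply: continuous_cvg; first exact: continuous_pos.
  apply: cvgB; first exact: cvg_cst.
  under eq_fun do rewrite wsum_mix.
  have : wsum X lam w + N.+1%:R^-1 * (wsum X mu w - wsum X lam w) @[N --> \oo] -->
         wsum X lam w + 0 * (wsum X mu w - wsum X lam w).
    by apply: cvgD; [exact: cvg_cst|apply: cvgMr_tmp; exact: cvg_harmonic].
  by rewrite mul0r addr0.
- exact: finite_measure_integrable_cst.
- move=> N w _ /=; rewrite mon0 mul1r lee_fin ger0_norm ?pos_ge0//.
  by apply: pos_sub_wsum; apply: mix_ge0; rewrite ?invr_ge0 ?invf_le1 ?ler1n.
Unshelve. all: by end_near.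
Qed.

End nonneg_weights.

(** * Comparison of the distribution functions *)

Section comparison.
Context {R : realType} d (T : measurableType d) (P : probability T R) (n : nat)
  (X : 'I_n -> {RV P >-> R}) (a b : R).
Hypotheses (a0 : 0 < a) (b0 : 0 < b) (iidX : iid_gamma X a b).
Local Notation Phi lam := (ltmom X lam (fun _ => 0%N)).
Local Notation K lam := (posmom X lam (fun _ => 0%N)).

(** Gamma variables are almost surely positive, so replacing them by their positive parts
    changes the event [W < x] by a null set only. *)
Lemma RV_gt0_proba1 : P (\bigcap_(i in [set: 'I_n]) X i @^-1` [set x | 0 < x]) = 1%E.
Proof.
have [indX lawX] := iidX.
have mpos : measurable [set x : R | 0 < x] by rewrite -set_itvoy.
have -> : [set: 'I_n] = [set` [set: 'I_n]%SET] by apply/seteqP; split => i //=; rewrite inE.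
rewrite (indX _ (fun _ => [set x | 0 < x]))// big1// => i _.
have -> : X i @^-1` [set x | 0 < x] = ~` (X i @^-1` [set x | x <= 0]).
  by apply/seteqP; split => w /=; [rewrite ltNge => /negP|move=> /negP; rewrite -ltNge].
have mle : measurable (X i @^-1` [set x | x <= 0]).
  by apply: measurable_RV_preimage; rewrite -set_itvNyc.
rewrite probability_setC//.
have lawE (V : set R) : measurable V -> distribution P (RV_GR X i) V = gamma_prob a b V.
  exact: lawX.
rewrite (_ : P _ = 0%E) ?sube0//.
exact: (gamma_law_le0 lawE).
Qed.

Lemma weighted_sum_probE (lam : 'rV[R]_n) x :
  weighted_sum_prob X lam x = (Phi (lam 0) x)%:E.
Proof.
pose D := ~` (\bigcap_(i in [set: 'I_n]) X i @^-1` [set x | 0 < x]).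
have mpos : measurable [set x : R | 0 < x] by rewrite -set_itvoy.
have mC : measurable (\bigcap_(i in [set: 'I_n]) X i @^-1` [set x | 0 < x]).
  by apply: fin_bigcap_measurable => // i _; exact: measurable_RV_preimage.
have mD : measurable D by exact: measurableC.
have D0 : P D = 0%E by rewrite probability_setC// RV_gt0_proba1 subee.
have mS : measurable [set w | \sum_(i < n) lam 0 i * X i w < x].
  rewrite (_ : [set w | _] = (fun w => \sum_(i < n) lam 0 i * X i w) @^-1` `]-oo, x[); last first.
    by apply/seteqP; split => w /=; rewrite in_itv.
  rewrite -[X in measurable X]setTI; apply: (_ : measurable_fun setT _) => //.
  apply: measurable_sum => i; apply: measurable_funM; first exact: measurable_cst.
  exact: measurable_funP.
have mW := measurable_wsum_lt X (lam 0) x.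
rewrite -prob_wsumE /weighted_sum_prob -(measureU0 mS mD D0) -(measureU0 mW mD D0).
congr (P _).
have E w : ~ D w -> \sum_(i < n) lam 0 i * X i w = wsum X (lam 0) w.
  move=> /contrapT Dw; apply: eq_bigr => i _; rewrite /pRV pos_id// ltW//.
  exact: (Dw i).
apply/seteqP; split => w; have [Dw|Dw] := pselect (D w); try by right.
  by move=> [/= h|//]; left; rewrite /= -E.
by move=> [/= h|//]; left; rewrite /= E.
Qed.

Variables (lam mu : 'I_n -> R).
Hypotheses (mu0 : forall k, 0 < mu k) (mudecr : forall i j : 'I_n, (i <= j)%N -> mu j <= mu i)
  (lam0 : forall k, 0 <= lam k)
  (psum : forall m, \sum_(k < n | (k < m)%N) mu k <= \sum_(k < n | (k < m)%N) lam k)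
  (sum : \sum_(k < n) mu k = \sum_(k < n) lam k).
Let s := \sum_(k < n) mu k.

Let mu_ge0 k : 0 <= mu k. Proof. exact: ltW. Qed.

(** The vectors on the segment from [lam] to [mu] have partial sums dominating those of
    [mu], and are positive except possibly at [lam].  The sign [c] lets increments be
    compared in either direction. *)
Lemma majorized_limit x y c :
  (forall nu (i j : 'I_n) e, (forall k, 0 < nu k) -> \sum_(k < n) nu k = s -> i != j -> 0 <= e ->
     nu j + e <= nu i - e ->
     c * (K nu y - K nu x) <= c * (K (transfer nu i j e) y - K (transfer nu i j e) x)) ->
  c * (K lam y - K lam x) <= c * (K mu y - K mu x).
Proof.
move=> H.
have cv : c * (K (mix lam mu N.+1%:R^-1) y - K (mix lam mu N.+1%:R^-1) x) @[N --> \oo] -->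
  c * (K lam y - K lam x).
  by apply: cvgMl_tmp; apply: cvgB; exact: posmom_mix_cvg.
apply: (cvgr_to_le cv); near=> N.
have t0 : 0 < (N.+1%:R^-1 : R) by rewrite invr_gt0.
have t1 : (N.+1%:R^-1 : R) <= 1 by rewrite invf_le1// ler1n.
apply: (transfer_majorization (F := fun nu => c * (K nu y - K nu x)) H) => //.
- exact: mix_gt0.
- move=> m; rewrite /mix big_split/= -mulr_sumr sumrB.
  rewrite -subr_ge0 (_ : _ - _ = (1 - N.+1%:R^-1) *
    (\sum_(k < n | (k < m)%N) lam k - \sum_(k < n | (k < m)%N) mu k)); last ring.
  by rewrite mulr_ge0 ?subr_ge0.
- by rewrite /mix big_split/= -mulr_sumr sumrB sum subrr mulr0 addr0.
Unshelve. all: by end_near.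
Qed.

(** For [y > x], [(y - x) * Phi lam x <= K lam y - K lam x <= K mu y - K mu x <=
    (y - x) * Phi mu y]; then [y] tends to [x], and continuity of [Phi mu] concludes. *)
Lemma ltmom_majorized_above (x : R) : 0 < x -> (a + 2^-1) * s / b <= x -> Phi lam x <= Phi mu x.
Proof.
move=> x0 sx.
have cv := cvg_at_right_filter (ltmom_cont a0 b0 iidX mu0 (nu := fun _ => 0%N) x0).
apply: (cvgr_to_ge cv); near=> y.
have xy : x < y by near: y; exact: nbhs_right_gt.
have := @majorized_limit x y 1; rewrite !mul1r => H.
have {}H : K lam y - K lam x <= K mu y - K mu x.
  apply: H => nu i j e nu0 nus ij e0 le_e; rewrite !mul1r.
  by apply: (transfer_above a0 b0 iidX) => //; rewrite ?nus// (ltW xy).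
have h1 := posmom0_subgrad X x y lam0.
have h2 := posmom0_subgrad X y x mu_ge0.
have yx : 0 < y - x by rewrite subr_gt0.
rewrite -/(Phi mu y) -(ler_pM2l yx); move: h1 h2 H; rewrite -(opprB y x) mulNr; lra.
Unshelve. all: by end_near.
Qed.

Lemma ltmom_majorized_below (y : R) : 0 < y ->
  (forall nu (i j : 'I_n), (forall k, 0 < nu k) -> \sum_(k < n) nu k = s -> i != j ->
     y <= ((a - 1) * s + nu i + nu j) / b) ->
  Phi mu y <= Phi lam y.
Proof.
move=> y0 ys.
have cv := cvg_at_left_filter (ltmom_cont a0 b0 iidX mu0 (nu := fun _ => 0%N) y0).
apply: (cvgr_to_le cv); near=> x.
have xy : x < y by near: x; exact: nbhs_left_lt.
have x0 : 0 < x by near: x; exact: nbhs_left_gt.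
have := @majorized_limit x y (-1); rewrite !mulN1r !lerN2 => H.
have {}H : K mu y - K mu x <= K lam y - K lam x.
  apply: H => nu i j e nu0 nus ij e0 le_e; rewrite !mulN1r lerN2.
  by apply: (transfer_below a0 b0 iidX) => //; rewrite ?(ltW x0) ?(ltW xy)// nus; exact: ys.
have h1 := posmom0_subgrad X x y mu_ge0.
have h2 := posmom0_subgrad X y x lam0.
have yx : 0 < y - x by rewrite subr_gt0.
rewrite -/(Phi mu x) -(ler_pM2l yx); move: h1 h2 H; rewrite -(opprB y x) mulNr; lra.
Unshelve. all: by end_near.
Qed.

End comparison.

Theorem theorem1 (R : realType) (n : nat) (n_ge1 : (1 <= n)%N)
    (a b : R) (a_gt0 : 0 < a) (b_gt0 : 0 < b)
    (d : measure_display) (T : measurableType d) (P : probability T R)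
    (X : 'I_n -> {RV P >-> R}) (iidX : iid_gamma X a b)
    (lam mu : 'rV[R]_n) (mu_lam : majorized mu lam)
    (s : R) (s_def : s = \sum_(i < n) lam 0 i) :
  [/\ forall x : R, 0 < x -> ((2 * a + 1) * s) / (2 * b) < x ->
        (weighted_sum_prob X lam x <= weighted_sum_prob X mu x)%E,
      n = 2%N -> forall x : R, 0 < x -> x < (a * s) / b ->
        (weighted_sum_prob X mu x <= weighted_sum_prob X lam x)%E
    & (3 <= n)%N -> 1 < a -> forall x : R, 0 < x -> x < ((a - 1) * s) / b ->
        (weighted_sum_prob X mu x <= weighted_sum_prob X lam x)%E].
Proof.
case: mu_lam => lam0 _ mu0 mudecr psum sum.
have {}psum m : \sum_(k < n | (k < m)%N) mu 0 k <= \sum_(k < n | (k < m)%N) lam 0 k.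
  have [mn|nm] := ltnP m n; first exact: psum.
  have E (k : 'I_n) : (k < m)%N = true by exact: leq_trans (ltn_ord k) nm.
  by under eq_bigl do rewrite E; under [leRHS]eq_bigl do rewrite E; rewrite sum.
have sE : \sum_(k < n) mu 0 k = s by rewrite s_def.
split=> [x x0 xs|n2 x x0 xs|_ _ x x0 xs].
- rewrite !(weighted_sum_probE iidX) lee_fin.
  apply: (ltmom_majorized_above a_gt0 b_gt0 iidX) => //; rewrite sE.
  rewrite (_ : _ * s / b = ((2 * a + 1) * s) / (2 * b)) ?ltW//.
  by field; rewrite gt_eqF.
- rewrite !(weighted_sum_probE iidX) lee_fin.
  apply: (ltmom_majorized_below a_gt0 b_gt0 iidX) => // nu i j nu0 nus ij.
  rewrite sE in nus *; rewrite (le_trans (ltW xs))// ler_pM2r ?invr_gt0//.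
  (* With two weights, [i] and [j] exhaust the sum. *)
  suff -> : s = nu i + nu j by lra.
  rewrite -nus (bigD1 i)//= (bigD1 j)//= ?[j == i]eq_sym// big1 ?addr0// => k /andP[ki kj].
  exfalso; move: ij ki kj (ltn_ord i) (ltn_ord j) (ltn_ord k); rewrite -!val_eqE/=.
  move: (nat_of_ord i) (nat_of_ord j) (nat_of_ord k) => p q r; rewrite n2.
  by case: p q r => [|[|//]] [|[|//]] [|[|//]].
- rewrite !(weighted_sum_probE iidX) lee_fin.
  apply: (ltmom_majorized_below a_gt0 b_gt0 iidX) => // nu i j nu0 nus ij.
  rewrite sE (le_trans (ltW xs))// ler_pM2r ?invr_gt0// -addrA lerDl.
  by rewrite addr_ge0// ltW.
Qed.
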